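(* Let $n,m\ge2$ and let $X=S^2(n,m)$ be the effective two-cone-point orbisphere, regarded as a compact complex orbifold with orbifold canonical bundle $K_X$. An orbifold half-form bundle $\delta$, i.e. an orbifold line bundle with $\delta^{\otimes2}\cong K_X$, exists if and only if $n$ and $m$ are both odd.
   Context: $S^2(n,m)$ is the complex 1-dimensional orbifold with underlying space $S^2\cong\mathbb{P}^1$ and exactly two cone points, with local models $D/\mathbb{Z}_n$ and $D/\mathbb{Z}_m$ ($D\subset\mathbb{C}$ a disk, the generator acting by $u\mapsto e^{2\pi i/n}u$, resp. $u\mapsto e^{2\pi i/m}u$). Orbifold line bundles are given on uniformizing charts by equivariant complex line bundles, glued by equivariant isomorphisms satisfying the cocycle condition; isomorphism is isomorphism of (smooth) orbifold line bundles. $K_X$ is the orbifold line bundle of $(1,0)$-forms, given on charts by the cotangent bundle $T^{*1,0}V$ with its induced group action. In Seifert data $(d_0;a,b)$, with $d_0\in\mathbb{Z}$ and isotropy weights $a\in\{0,\dots,n-1\}$, $b\in\{0,\dots,m-1\}$ (the chart generators act on the fibers over the cone points by $e^{2\pi i a/n}$ and $e^{2\pi i b/m}$) and orbifold degree $d_0+\frac an+\frac bm$, the paper's normalization is $K_X\cong L_{(-2;n-1,m-1)}$. *)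

(* Defs.v *)
From Stdlib Require Import Reals ZArith Lra Lia.
From Coquelicot Require Import Coquelicot.

Open Scope C_scope.

(** [real_class k U f]: all iterated partial derivatives of [f] of order at most
    [k] exist and are continuous on [U], for [U] open in the plane [C = R * R]. *)
Fixpoint real_class (k : nat) (U : C -> Prop) (f : C -> R) : Prop :=
  (forall z, U z -> @continuous C_UniformSpace R_UniformSpace f z) /\
  match k with
  | O => True
  | S k' => exists fx fy : C -> R,
      (forall z, U z -> is_derive (fun t : R => f (t, snd z)) (fst z) (fx z)) /\
      (forall z, U z -> is_derive (fun t : R => f (fst z, t)) (snd z) (fy z)) /\
      real_class k' U fx /\ real_class k' U fy
  end.

Definition class_C (k : nat) (U : C -> Prop) (f : C -> C) : Prop :=
  real_class k U (fun z => Re (f z)) /\ real_class k U (fun z => Im (f z)).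

Definition smooth_on (U : C -> Prop) (f : C -> C) : Prop :=
  forall k, class_C k U f.

(** Holomorphic functions are automatically smooth; smoothness is required here
    because neither Goursat's theorem nor Cauchy's formula is available. *)
Definition holomorphic_on (U : C -> Prop) (f : C -> C) : Prop :=
  smooth_on U f /\ forall z, U z -> ex_derive f z.

Lemma real_class_continuous k U f z : real_class k U f -> U z ->
  @continuous C_UniformSpace R_UniformSpace f z.
Proof. destruct k; intros [H _] Uz; exact (H z Uz). Qed.

Lemma real_class_sub k (U V : C -> Prop) f :
  (forall z, V z -> U z) -> real_class k U f -> real_class k V f.
Proof.
  intros VU; revert f; induction k as [|k IH]; simpl; intros f [Hc H].
  - split; auto.
  - split; [auto|]. destruct H as (fx & fy & Hx & Hy & Cx & Cy).
    exists fx, fy; split; [|split; [|split]]; auto.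
Qed.

Lemma real_class_pred k U f : real_class (S k) U f -> real_class k U f.
Proof.
  revert f; induction k as [|k IH]; intros f [Hc H].
  - split; auto.
  - destruct H as (fx & fy & Hx & Hy & Cx & Cy).
    split; [exact Hc|]. exists fx, fy; split; [|split; [|split]]; auto.
Qed.

Lemma slice_x (U : C -> Prop) z : @open C_UniformSpace U -> U z ->
  locally (fst z) (fun t : R => U (t, snd z)).
Proof.
  intros oU Uz. destruct (oU z Uz) as [e He]. exists e; intros t Ht.
  apply He; split; [exact Ht | apply ball_center].
Qed.

Lemma slice_y (U : C -> Prop) z : @open C_UniformSpace U -> U z ->
  locally (snd z) (fun t : R => U (fst z, t)).
Proof.
  intros oU Uz. destruct (oU z Uz) as [e He]. exists e; intros t Ht.
  apply He; split; [apply ball_center | exact Ht].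
Qed.

Lemma real_class_ext k (U : C -> Prop) f g : @open C_UniformSpace U ->
  (forall z, U z -> f z = g z) -> real_class k U f -> real_class k U g.
Proof.
  intros oU E H.
  assert (Hc : forall z, U z -> @continuous C_UniformSpace R_UniformSpace g z).
  { intros z Uz.
    apply (@continuous_ext_loc C_UniformSpace R_UniformSpace g f).
    - destruct (oU z Uz) as [e He]. exists e; intros y Hy; apply E, He, Hy.
    - exact (real_class_continuous k U f z H Uz). }
  destruct k as [|k]; [split; auto|].
  destruct H as [_ (fx & fy & Hx & Hy & Cx & Cy)].
  split; [exact Hc|]. exists fx, fy; split; [|split; [|split]]; auto; intros z Uz.
  - apply is_derive_ext_loc with (fun t : R => f (t, snd z)); [|auto].
    apply filter_imp with (2 := slice_x U z oU Uz); intros t; apply E.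
  - apply is_derive_ext_loc with (fun t : R => f (fst z, t)); [|auto].
    apply filter_imp with (2 := slice_y U z oU Uz); intros t; apply E.
Qed.

Lemma real_class_const k U (c : R) : real_class k U (fun _ => c).
Proof.
  revert c; induction k as [|k IH]; intros c; simpl;
    (split; [intros; apply continuous_const|]); auto.
  exists (fun _ => 0%R), (fun _ => 0%R).
  split; [|split; [|split]]; auto; intros; apply @is_derive_const.
Qed.

Lemma real_class_plus k U f g : real_class k U f -> real_class k U g ->
  real_class k U (fun z => (f z + g z)%R).
Proof.
  revert f g; induction k as [|k IH]; intros f g Hf Hg; simpl.
  - split; auto; intros z Uz.
    apply (@continuous_plus C_UniformSpace R_AbsRing R_NormedModule);
      [apply (real_class_continuous 0 U) | apply (real_class_continuous 0 U)]; auto.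
  - split.
    + intros z Uz.
      apply (@continuous_plus C_UniformSpace R_AbsRing R_NormedModule);
      [apply (real_class_continuous (S k) U) | apply (real_class_continuous (S k) U)]; auto.
    + destruct Hf as [_ (fx & fy & Fx & Fy & CFx & CFy)].
      destruct Hg as [_ (gx & gy & Gx & Gy & CGx & CGy)].
      exists (fun z => fx z + gx z)%R, (fun z => fy z + gy z)%R.
      split; [|split; [|split]]; auto; intros z Uz;
        apply (@is_derive_plus R_AbsRing R_NormedModule); auto.
Qed.

Lemma real_class_opp k U f : real_class k U f -> real_class k U (fun z => (- f z)%R).
Proof.
  revert f; induction k as [|k IH]; intros f Hf.
  - split; auto; intros z Uz.
    apply (@continuous_opp C_UniformSpace R_AbsRing R_NormedModule).
    apply (real_class_continuous 0 U); auto.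
  - split.
    + intros z Uz.
      apply (@continuous_opp C_UniformSpace R_AbsRing R_NormedModule).
      apply (real_class_continuous (S k) U); auto.
    + destruct Hf as [_ (fx & fy & Fx & Fy & CFx & CFy)].
      exists (fun z => - fx z)%R, (fun z => - fy z)%R.
      split; [|split; [|split]]; auto; intros z Uz;
        apply (@is_derive_opp R_AbsRing R_NormedModule); auto.
Qed.

Lemma real_class_mult k U f g : real_class k U f -> real_class k U g ->
  real_class k U (fun z => (f z * g z)%R).
Proof.
  revert f g; induction k as [|k IH]; intros f g Hf Hg.
  - split; auto; intros z Uz.
    apply (@continuous_mult C_UniformSpace R_AbsRing);
      [apply (real_class_continuous 0 U) | apply (real_class_continuous 0 U)]; auto.
  - pose proof (real_class_pred _ _ _ Hf) as Hf'.
    pose proof (real_class_pred _ _ _ Hg) as Hg'.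
    split.
    + intros z Uz.
      apply (@continuous_mult C_UniformSpace R_AbsRing);
      [apply (real_class_continuous (S k) U) | apply (real_class_continuous (S k) U)]; auto.
    + destruct Hf as [_ (fx & fy & Fx & Fy & CFx & CFy)].
      destruct Hg as [_ (gx & gy & Gx & Gy & CGx & CGy)].
      exists (fun z => fx z * g z + f z * gx z)%R, (fun z => fy z * g z + f z * gy z)%R.
      split; [|split; [|split]]; try (apply real_class_plus; apply IH; assumption);
        intros [x y] Uz; simpl.
      * apply (@is_derive_mult R_AbsRing (fun t => f (t, y)) (fun t => g (t, y)));
          [apply (Fx (x, y) Uz) | apply (Gx (x, y) Uz) | apply Rmult_comm].
      * apply (@is_derive_mult R_AbsRing (fun t => f (x, t)) (fun t => g (x, t)));
          [apply (Fy (x, y) Uz) | apply (Gy (x, y) Uz) | apply Rmult_comm].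
Qed.

Lemma real_class_inv k U f : (forall z, U z -> f z <> 0%R) -> real_class k U f ->
  real_class k U (fun z => (/ f z)%R).
Proof.
  intros nz; revert f nz; induction k as [|k IH]; intros f nz Hf.
  - split; auto; intros z Uz. apply (@continuous_comp C_UniformSpace R_UniformSpace R_UniformSpace f Rinv);
      [|apply continuous_Rinv, nz; exact Uz].
    apply (real_class_continuous 0 U); auto.
  - pose proof (real_class_pred _ _ _ Hf) as Hf'. split.
    + intros z Uz. apply (@continuous_comp C_UniformSpace R_UniformSpace R_UniformSpace f Rinv);
      [|apply continuous_Rinv, nz; exact Uz].
      apply (real_class_continuous (S k) U); auto.
    + destruct Hf as [_ (fx & fy & Fx & Fy & CFx & CFy)].
      exists (fun z => (-1 * fx z) * (/ f z * / f z))%R,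
             (fun z => (-1 * fy z) * (/ f z * / f z))%R.
      split; [|split; [|split]];
        try (apply real_class_mult; apply real_class_mult; auto using real_class_const);
        intros [x y] Uz; simpl.
      * replace (-1 * fx (x, y) * (/ f (x, y) * / f (x, y)))%R
          with (- fx (x, y) / f (x, y) ^ 2)%R by (field; auto).
        apply (is_derive_inv (fun t => f (t, y)));
          [apply (Fx (x, y) Uz) | auto].
      * replace (-1 * fy (x, y) * (/ f (x, y) * / f (x, y)))%R
          with (- fy (x, y) / f (x, y) ^ 2)%R by (field; auto).
        apply (is_derive_inv (fun t => f (x, t)));
          [apply (Fy (x, y) Uz) | auto].
Qed.

Lemma real_class_sqr k U f : real_class k U f -> real_class k U (fun z => (f z ^ 2)%R).
Proof.
  intros H.
  exact (real_class_mult k U _ _ H (real_class_mult k U _ _ H (real_class_const k U 1))).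
Qed.

Lemma class_C_ext k (U : C -> Prop) (f g : C -> C) : @open C_UniformSpace U ->
  (forall z, U z -> f z = g z) -> class_C k U f -> class_C k U g.
Proof.
  intros oU E [H1 H2]; split.
  - apply (real_class_ext k U _ _ oU) with (2 := H1); intros z Uz; now rewrite (E z Uz).
  - apply (real_class_ext k U _ _ oU) with (2 := H2); intros z Uz; now rewrite (E z Uz).
Qed.

Lemma class_C_const k U (c : C) : class_C k U (fun _ => c).
Proof. split; apply real_class_const. Qed.

Lemma class_C_id k U : class_C k U (fun z => z).
Proof.
  split; destruct k as [|k];
    (split; [intros; first [apply @continuous_fst | apply @continuous_snd]|]); auto.
  - exists (fun _ => 1%R), (fun _ => 0%R). split; [|split; [|split]];
      try apply real_class_const; intros; unfold Re; simpl;
      [apply @is_derive_id | apply @is_derive_const].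
  - exists (fun _ => 0%R), (fun _ => 1%R). split; [|split; [|split]];
      try apply real_class_const; intros; unfold Im; simpl;
      [apply @is_derive_const | apply @is_derive_id].
Qed.

Lemma class_C_mult k (U : C -> Prop) (f g : C -> C) :
  class_C k U f -> class_C k U g -> class_C k U (fun z => f z * g z).
Proof.
  intros [F1 F2] [G1 G2]; split; simpl.
  - apply (real_class_plus k U (fun z => Re (f z) * Re (g z))%R
             (fun z => - (Im (f z) * Im (g z)))%R).
    + now apply real_class_mult.
    + now apply real_class_opp, real_class_mult.
  - apply (real_class_plus k U (fun z => Re (f z) * Im (g z))%R
             (fun z => Im (f z) * Re (g z))%R); now apply real_class_mult.
Qed.

Lemma class_C_inv k (U : C -> Prop) (f : C -> C) : (forall z, U z -> f z <> 0) ->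
  class_C k U f -> class_C k U (fun z => / f z).
Proof.
  intros nz [F1 F2].
  assert (N : real_class k U (fun z => / (Re (f z) ^ 2 + Im (f z) ^ 2))%R).
  { apply real_class_inv; [|apply real_class_plus; now apply real_class_sqr].
    intros z Uz; generalize (nz z Uz); generalize (f z); intros [a b] nzz; simpl.
    intros E; apply nzz.
    assert (a = 0%R) by nra. assert (b = 0%R) by nra. now subst. }
  split.
  - exact (real_class_mult k U _ _ F1 N).
  - exact (real_class_mult k U _ _ (real_class_opp k U _ F2) N).
Qed.

Lemma smooth_on_sub (U V : C -> Prop) (f : C -> C) :
  (forall z, V z -> U z) -> smooth_on U f -> smooth_on V f.
Proof. intros VU H k; split; eapply real_class_sub; eauto; apply H. Qed.

Lemma smooth_on_ext (U : C -> Prop) (f g : C -> C) : @open C_UniformSpace U ->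
  (forall z, U z -> f z = g z) -> smooth_on U f -> smooth_on U g.
Proof. intros oU E H k; now apply (class_C_ext k U f). Qed.

Lemma smooth_on_const U (c : C) : smooth_on U (fun _ => c).
Proof. intros k; apply class_C_const. Qed.

Lemma smooth_on_mult (U : C -> Prop) (f g : C -> C) :
  smooth_on U f -> smooth_on U g -> smooth_on U (fun z => f z * g z).
Proof. intros Hf Hg k; now apply class_C_mult. Qed.

Lemma smooth_on_div (U : C -> Prop) (f g : C -> C) : (forall z, U z -> g z <> 0) ->
  smooth_on U f -> smooth_on U g -> smooth_on U (fun z => f z / g z).
Proof.
  intros nz Hf Hg k; apply class_C_mult; [apply Hf | now apply class_C_inv].
Qed.

Lemma is_derive_along (L : C -> R) (g : R -> C) (d : C) (t0 : R) (f : C -> C) (l : C) :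
  (forall v w, L (v - w) = (L v - L w)%R) ->
  (forall (r : R) w, L (r * w) = (r * L w)%R) ->
  (forall w, (Rabs (L w) <= Cmod w)%R) ->
  Cmod d = 1%R -> (forall t : R, g t - g t0 = (t - t0)%R * d) ->
  @is_derive C_AbsRing C_NormedModule f (g t0) l ->
  is_derive (fun t : R => L (f (g t))) t0 (L (d * l)).
Proof.
  intros Lm Ls Lb d1 Hg [_ H].
  split; [apply is_linear_scal_l|].
  intros x Hx e. apply (@is_filter_lim_locally_unique R_AbsRing R_NormedModule) in Hx. subst x.
  specialize (H (g t0) (fun P HP => HP) e).
  destruct H as [dl Hd]. exists dl; intros t Ht.
  change (Rabs (t - t0) < dl) in Ht.
  assert (E : Cmod (g t - g t0) = Rabs (t - t0)).
  { rewrite Hg, Cmod_mult, d1, Cmod_R; ring. }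
  specialize (Hd (g t)).
  assert (B : ball (M := AbsRing_UniformSpace C_AbsRing) (g t0) dl (g t)).
  { change (Cmod (g t - g t0) < dl); rewrite E; exact Ht. }
  specialize (Hd B).
  change (Cmod ((f (g t) - f (g t0)) - (g t - g t0) * l)%C <= e * Cmod (g t - g t0)%C)%R in Hd.
  change (Rabs ((L (f (g t)) - L (f (g t0))) - (t - t0) * L (d * l)%C) <= e * Rabs (t - t0))%R.
  rewrite E in Hd. eapply Rle_trans; [|exact Hd].
  rewrite <- Ls, <- !Lm, Cmult_assoc, <- Hg. apply Lb.
Qed.

Lemma Re_le_Cmod w : (Rabs (Re w) <= Cmod w)%R.
Proof. eapply Rle_trans; [apply Rmax_l | apply Rmax_Cmod]. Qed.

Lemma Im_le_Cmod w : (Rabs (Im w) <= Cmod w)%R.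
Proof. eapply Rle_trans; [apply Rmax_r | apply Rmax_Cmod]. Qed.

Lemma is_C_derive_partial (f : C -> C) (z l : C) : @is_derive C_AbsRing C_NormedModule f z l ->
  (is_derive (fun t : R => Re (f (t, snd z))) (fst z) (Re l) /\
   is_derive (fun t : R => Im (f (t, snd z))) (fst z) (Im l)) /\
  (is_derive (fun t : R => Re (f (fst z, t))) (snd z) (Re (Ci * l)) /\
   is_derive (fun t : R => Im (f (fst z, t))) (snd z) (Im (Ci * l))).
Proof.
  destruct z as [x y]; simpl fst; simpl snd; intros H.
  rewrite <- (Cmult_1_l l) at 1 2.
  split; split.
  - apply (is_derive_along Re (fun t => (t, y)) 1 x); auto using Re_le_Cmod, Cmod_1;
      intros; unfold Re, Cminus, Cplus, Copp, Cmult, RtoC; simpl; try ring; f_equal; ring.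
  - apply (is_derive_along Im (fun t => (t, y)) 1 x); auto using Im_le_Cmod, Cmod_1;
      intros; unfold Im, Cminus, Cplus, Copp, Cmult, RtoC; simpl; try ring; f_equal; ring.
  - apply (is_derive_along Re (fun t => (x, t)) Ci y); auto using Re_le_Cmod, Cmod_Ci;
      intros; unfold Re, Cminus, Cplus, Copp, Cmult, RtoC, Ci; simpl; try ring; f_equal; ring.
  - apply (is_derive_along Im (fun t => (x, t)) Ci y); auto using Im_le_Cmod, Cmod_Ci;
      intros; unfold Im, Cminus, Cplus, Copp, Cmult, RtoC, Ci; simpl; try ring; f_equal; ring.
Qed.

Lemma is_C_derive_continuous (f : C -> C) (z l : C) : @is_derive C_AbsRing C_NormedModule f z l ->
  @continuous C_UniformSpace C_UniformSpace f z.
Proof.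
  intros H.
  assert (Hc : @continuous (AbsRing_UniformSpace C_AbsRing)
                 (NormedModule.UniformSpace C_AbsRing C_NormedModule) f z)
    by (apply ex_derive_continuous; now exists l).
  intros P HP. apply locally_C. exact (Hc P HP).
Qed.

Lemma smooth_on_C_derive (U : C -> Prop) (f : C -> C) : holomorphic_on U f -> @open C_UniformSpace U ->
  smooth_on U (C_derive f).
Proof.
  intros [Hs Hd] oU k. destruct (Hs (S k)) as [H1 H2].
  destruct H1 as [_ (rx & ry & Rx & _ & Crx & _)].
  destruct H2 as [_ (ix & iy & Ix & _ & Cix & _)].
  assert (E : forall z, U z -> rx z = Re (C_derive f z) /\ ix z = Im (C_derive f z)).
  { intros z Uz.
    destruct (is_C_derive_partial f z _ (C_derive_correct f z 0 (Hd z Uz))) as [[A B] _].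
    split.
    - rewrite <- (is_derive_unique _ _ _ (Rx z Uz)). now apply is_derive_unique.
    - rewrite <- (is_derive_unique _ _ _ (Ix z Uz)). now apply is_derive_unique. }
  split; [apply (real_class_ext k U _ _ oU) with (2 := Crx) | apply (real_class_ext k U _ _ oU) with (2 := Cix)];
    intros z Uz; apply E, Uz.
Qed.

(** A function given together with its complex derivative [g] is smooth as soon
    as [g] inherits every order of differentiability of [f]. *)
Lemma smooth_on_of_derive (U : C -> Prop) (f g : C -> C) :
  (forall z, U z -> @is_derive C_AbsRing C_NormedModule f z (g z)) ->
  (forall k, class_C k U f -> class_C k U g) ->
  smooth_on U f.
Proof.
  intros Hd Hg.
  assert (Hc : forall z, U z -> @continuous C_UniformSpace C_UniformSpace f z)
    by (intros z Uz; exact (is_C_derive_continuous f z _ (Hd z Uz))).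
  assert (c1 : forall z, U z -> @continuous C_UniformSpace R_UniformSpace (fun z => Re (f z)) z).
  { intros z Uz. apply (@continuous_comp C_UniformSpace C_UniformSpace R_UniformSpace f Re);
      [now apply Hc | apply @continuous_fst]. }
  assert (c2 : forall z, U z -> @continuous C_UniformSpace R_UniformSpace (fun z => Im (f z)) z).
  { intros z Uz. apply (@continuous_comp C_UniformSpace C_UniformSpace R_UniformSpace f Im);
      [now apply Hc | apply @continuous_snd]. }
  intros k; induction k as [|k IH]; [repeat split; auto|].
  assert (G := Hg k IH).
  assert (iG := class_C_mult k U _ _ (class_C_const k U Ci) G).
  split; (split; [assumption|]).
  - exists (fun z => Re (g z)), (fun z => Re (Ci * g z)).
    split; [|split; [|split; [apply G | apply iG]]];
      intros z Uz; apply (is_C_derive_partial f z (g z) (Hd z Uz)).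
  - exists (fun z => Im (g z)), (fun z => Im (Ci * g z)).
    split; [|split; [|split; [apply G | apply iG]]];
      intros z Uz; apply (is_C_derive_partial f z (g z) (Hd z Uz)).
Qed.

Lemma is_C_derive_comp (f g : C -> C) (z df dg : C) :
  @is_derive C_AbsRing C_NormedModule f (g z) df ->
  @is_derive C_AbsRing C_NormedModule g z dg ->
  @is_derive C_AbsRing C_NormedModule (fun x => f (g x)) z (dg * df).
Proof.
  intros Hf [_ Hg].
  apply (@is_derive_comp C_AbsRing C_NormedModule f g z df dg Hf).
  split; [apply is_linear_scal_l | exact Hg].
Qed.

Lemma is_C_derive_scale (c z : C) :
  @is_derive C_AbsRing C_NormedModule (fun w => w * c) z c.
Proof.
  assert (H : @is_derive C_AbsRing C_NormedModule (fun w => w * c) z (1 * c))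
    by exact (@is_derive_scal_l C_AbsRing C_NormedModule (fun w => w) z (RtoC 1) c
                (@is_derive_id C_AbsRing z)).
  now rewrite Cmult_1_l in H.
Qed.

Lemma continuous_scale (c z : C) :
  @continuous C_UniformSpace C_UniformSpace (fun w => w * c) z.
Proof.
  exact (is_C_derive_continuous _ _ _ (is_C_derive_scale c z)).
Qed.

(** Chart [i] is a uniformizing chart: the disk of radius [radius i], with
    Z/(order i) acting by rotations and [proj i] the quotient map. *)
Record atlas : Type := Atlas {
  space : Type;
  chart : Type;
  radius : chart -> R;
  order : chart -> nat;
  proj : chart -> C -> space
}.

Definition dom (X : atlas) (i : chart X) (z : C) : Prop := (Cmod z < radius X i)%R.

Definition rotation (k : nat) : C := (cos (2 * PI / INR k), sin (2 * PI / INR k)).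

(** The changes of charts are all local biholomorphisms between charts over the
    identity of the underlying space. For [i = j] they include the action of the
    local group. *)
Record change (X : atlas) (i j : chart X) : Type := Change {
  source : C -> Prop;
  change_map :> C -> C;
  source_open : @open C_UniformSpace source;
  source_dom : forall z, source z -> dom X i z;
  target_dom : forall z, source z -> dom X j (change_map z);
  change_holomorphic : holomorphic_on source change_map;
  change_etale : forall z, source z -> C_derive change_map z <> 0;
  change_proj : forall z, source z -> proj X j (change_map z) = proj X i z
}.
Arguments source {X i j} _ _.
Arguments change_map {X i j} _ _.
Arguments source_open {X i j} _.
Arguments source_dom {X i j} _ _ _.
Arguments target_dom {X i j} _ _ _.
Arguments change_holomorphic {X i j} _.
Arguments change_etale {X i j} _ _ _.
Arguments change_proj {X i j} _ _ _.

(** The topology of the underlying space is the one induced by the charts. *)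
Definition open_in (X : atlas) (A : space X -> Prop) : Prop :=
  forall i : chart X, @open C_UniformSpace (fun z => dom X i z /\ A (proj X i z)).

Record orbifold : Type := Orbifold {
  orbifold_atlas :> atlas;
  radius_pos : forall i, (0 < radius orbifold_atlas i)%R;
  order_pos : forall i, (1 <= order orbifold_atlas i)%nat;
  charts_cover : forall p, exists i z,
    dom orbifold_atlas i z /\ proj orbifold_atlas i z = p;
  proj_orbit : forall i z w, dom orbifold_atlas i z -> dom orbifold_atlas i w ->
    (proj orbifold_atlas i z = proj orbifold_atlas i w <->
     exists k, w = rotation (order orbifold_atlas i) ^ k * z);
  charts_compatible : forall i j z w,
    dom orbifold_atlas i z -> dom orbifold_atlas j w ->
    proj orbifold_atlas i z = proj orbifold_atlas j w ->
    exists p : change orbifold_atlas i j, source p z /\ p z = w;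
  charts_countable : exists e : nat -> chart orbifold_atlas, forall i, exists k, e k = i;
  hausdorff : forall p q, p <> q -> exists A B : space orbifold_atlas -> Prop,
    open_in orbifold_atlas A /\ open_in orbifold_atlas B /\ A p /\ B q /\
    forall r, A r -> B r -> False
}.

(** A smooth complex line bundle over an open set [V]. Each fiber is identified,
    as a bare vector space, with [C]; these identifications need not vary
    continuously, and the smooth structure is carried by a family of local frames
    whose quotients are smooth. Every line bundle is of this form, by choosing
    one nonzero vector in every fiber. *)
Record line_bundle (V : C -> Prop) : Type := LineBundle {
  frame_index : Type;
  frame_dom : frame_index -> C -> Prop;
  frame : frame_index -> C -> C;
  frame_open : forall a, @open C_UniformSpace (frame_dom a);
  frame_sub : forall a z, frame_dom a z -> V z;
  frame_cover : forall z, V z -> exists a, frame_dom a z;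
  frame_neq0 : forall a z, frame_dom a z -> frame a z <> 0;
  frame_smooth : forall a b,
    smooth_on (fun z => frame_dom a z /\ frame_dom b z) (fun z => frame a z / frame b z)
}.
Arguments frame_index {V} _.
Arguments frame_dom {V _} _ _.
Arguments frame {V _} _ _.
Arguments frame_open {V _} _.
Arguments frame_sub {V _} _ _ _.
Arguments frame_cover {V} _ _ _.
Arguments frame_neq0 {V _} _ _ _.
Arguments frame_smooth {V _} _ _.

(** Every change of charts [p] from [i] to [j] comes with an isomorphism from the
    bundle on chart [i], over [source p], to the pullback by [p] of the bundle on
    chart [j]: it maps the fiber over [z] to the fiber over [p z] as
    multiplication by [glue p z]. The lift of the local group action to the bundle
    on chart [i] is given by the changes of charts from [i] to itself, and
    [glue_comp] contains the compatibility with restrictions, the equivariance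
    and the cocycle condition. *)
Record orbi_line_bundle (X : orbifold) : Type := OrbiLineBundle {
  chart_bundle : forall i : chart X, line_bundle (dom X i);
  glue : forall i j : chart X, change X i j -> C -> C;
  glue_neq0 : forall i j (p : change X i j) z, source p z -> glue i j p z <> 0;
  glue_smooth : forall i j (p : change X i j)
      (a : frame_index (chart_bundle i)) (b : frame_index (chart_bundle j)),
    smooth_on (fun z => source p z /\ frame_dom a z /\ frame_dom b (p z))
              (fun z => glue i j p z * frame a z / frame b (p z));
  glue_comp : forall i j k (p : change X i j) (q : change X j k) (r : change X i k),
    (forall z, source r z -> source p z /\ source q (p z) /\ r z = q (p z)) ->
    forall z, source r z -> glue i k r z = glue j k q (p z) * glue i j p z
}.
Arguments chart_bundle {X} _ _.
Arguments glue {X} _ {i j} _ _.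
Arguments glue_neq0 {X} _ {i j} _ _ _.
Arguments glue_smooth {X} _ {i j} _ _ _.
Arguments glue_comp {X} _ {i j k} _ _ _ _ _ _.

Definition isomorphic {X : orbifold} (L M : orbi_line_bundle X) : Prop :=
  exists h : chart X -> C -> C,
    (forall i z, dom X i z -> h i z <> 0) /\
    (forall i (a : frame_index (chart_bundle L i)) (b : frame_index (chart_bundle M i)),
       smooth_on (fun z => frame_dom a z /\ frame_dom b z)
                 (fun z => h i z * frame a z / frame b z)) /\
    (forall i j (p : change X i j) z, source p z ->
       h j (p z) * glue L p z = glue M p z * h i z).

#[local] Obligation Tactic := idtac.

Program Definition line_tensor {V : C -> Prop} (E F : line_bundle V) : line_bundle V :=
  {| frame_index := (frame_index E * frame_index F)%type;
     frame_dom := fun a z => frame_dom (fst a) z /\ frame_dom (snd a) z;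
     frame := fun a z => frame (fst a) z * frame (snd a) z |}.
Next Obligation. intros V E F a. apply open_and; apply frame_open. Qed.
Next Obligation. intros V E F a z [H _]. exact (frame_sub _ _ H). Qed.
Next Obligation.
  intros V E F z Vz. destruct (frame_cover E z Vz) as [a Ha], (frame_cover F z Vz) as [b Hb].
  now exists (a, b).
Qed.
Next Obligation. intros V E F a z [Ha Hb]. apply Cmult_neq_0; now apply frame_neq0. Qed.
Next Obligation.
  intros V E F [a1 a2] [b1 b2]; cbn [fst snd].
  apply (smooth_on_ext _ (fun z => (frame a1 z / frame b1 z) * (frame a2 z / frame b2 z))).
  - apply open_and; apply open_and; apply frame_open.
  - intros z [_ [h1 h2]]. field; split; now apply frame_neq0.
  - apply smooth_on_mult.
    + eapply smooth_on_sub; [|apply frame_smooth]. simpl; tauto.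
    + eapply smooth_on_sub; [|apply frame_smooth]. simpl; tauto.
Qed.

Lemma open_preimage (U V : C -> Prop) (f : C -> C) : @open C_UniformSpace U ->
  holomorphic_on U f -> @open C_UniformSpace V ->
  @open C_UniformSpace (fun z => U z /\ V (f z)).
Proof.
  intros oU [_ hf] oV z [Uz Vz].
  destruct (hf z Uz) as [l Hl].
  assert (H := is_C_derive_continuous f z l Hl V (oV _ Vz)).
  generalize (filter_and _ _ (oU z Uz) H). apply filter_imp; tauto.
Qed.

Program Definition tensor {X : orbifold} (L M : orbi_line_bundle X) : orbi_line_bundle X :=
  {| chart_bundle := fun i => line_tensor (chart_bundle L i) (chart_bundle M i);
     glue := fun i j p z => glue L p z * glue M p z |}.
Next Obligation. intros X L M i j p z H. apply Cmult_neq_0; now apply glue_neq0. Qed.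
Next Obligation.
  intros X L M i j p [a1 a2] [b1 b2]; cbn [fst snd line_tensor frame_dom frame].
  apply (smooth_on_ext _ (fun z => (glue L p z * frame a1 z / frame b1 (p z)) *
                                   (glue M p z * frame a2 z / frame b2 (p z)))).
  - apply (open_ext (fun z => (source p z /\ (frame_dom b1 (p z) /\ frame_dom b2 (p z))) /\
                              (frame_dom a1 z /\ frame_dom a2 z))); [intros; tauto|].
    apply open_and; [|apply open_and; apply frame_open].
    apply (open_preimage _ (fun w => frame_dom b1 w /\ frame_dom b2 w)).
    + apply source_open.
    + apply change_holomorphic.
    + apply open_and; apply frame_open.
  - intros z (_ & _ & h1 & h2). field; split; now apply frame_neq0.
  - apply smooth_on_mult.
    + eapply smooth_on_sub; [|apply glue_smooth]. simpl; tauto.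
    + eapply smooth_on_sub; [|apply glue_smooth]. simpl; tauto.
Qed.
Next Obligation.
  intros X L M i j k p q r H z Hz; cbv beta.
  rewrite (glue_comp L p q r H z Hz), (glue_comp M p q r H z Hz). ring.
Qed.

Lemma open_disk (r : R) : @open C_UniformSpace (fun z => (Cmod z < r)%R).
Proof.
  apply (@open_comp C_UniformSpace R_UniformSpace Cmod (fun x => (x < r)%R)); [|apply open_lt].
  intros z _.
  apply (@continuous_comp C_UniformSpace R_UniformSpace R_UniformSpace
           (fun z => (fst z ^ 2 + snd z ^ 2)%R) sqrt).
  - destruct (class_C_id 0 (fun _ => True)) as [H1 H2].
    exact (proj1 (real_class_plus 0 _ _ _ (real_class_sqr 0 _ _ H1) (real_class_sqr 0 _ _ H2))
             z I).
  - apply continuity_pt_filterlim, continuity_pt_sqrt.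
    apply Rplus_le_le_0_compat; apply pow2_ge_0.
Qed.

(** The bundle of (1,0)-forms, with global frame [dz]. *)
Program Definition cotangent (V : C -> Prop) (oV : @open C_UniformSpace V) : line_bundle V :=
  {| frame_index := unit;
     frame_dom := fun _ => V;
     frame := fun _ _ => 1 |}.
Next Obligation. intros V oV a. exact oV. Qed.
Next Obligation. intros V oV a z H. exact H. Qed.
Next Obligation. intros V oV z H. exists tt. exact H. Qed.
Next Obligation. intros. apply C1_nz. Qed.
Next Obligation. intros V oV a b. exact (smooth_on_const _ (1 / 1)). Qed.

(** A change of charts [w = p z] acts on (1,0)-forms by pullback along its local
    inverse, so that [dz] is mapped to [dw] divided by [p' z]. In particular the
    generator [rotation k] of a local group acts on the fiber over the cone point
    by its inverse, that is, with weight [k - 1]. *)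
Program Definition canonical (X : orbifold) : orbi_line_bundle X :=
  {| chart_bundle := fun i => cotangent (dom X i) (open_disk (radius X i));
     glue := fun i j p z => / C_derive p z |}.
Next Obligation.
  intros X i j p z Hz E. apply C1_nz.
  rewrite <- (Cinv_r _ (change_etale p z Hz)), E. ring.
Qed.
Next Obligation.
  intros X i j p a b; cbn.
  apply (smooth_on_sub (source p)); [tauto|].
  apply (smooth_on_ext _ (fun z => 1 / C_derive p z)).
  - apply source_open.
  - intros z Hz. field. now apply change_etale.
  - apply smooth_on_div; [apply change_etale | apply smooth_on_const |].
    apply smooth_on_C_derive; [apply change_holomorphic | apply source_open].
Qed.
Next Obligation.
  intros X i j k p q r H z Hz; cbv beta. destruct (H z Hz) as (Hp & Hq & _).
  assert (E : C_derive r z = C_derive p z * C_derive q (p z)).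
  { apply is_C_derive_unique.
    apply (@is_derive_ext_loc C_AbsRing C_NormedModule (fun z => q (p z))).
    - apply locally_C. apply filter_imp with (2 := source_open r z Hz).
      intros y Hy. symmetry. apply H, Hy.
    - apply is_C_derive_comp; apply (C_derive_correct _ _ 0).
      + apply (proj2 (change_holomorphic q)), Hq.
      + apply (proj2 (change_holomorphic p)), Hp. }
  rewrite E. field. split; now apply change_etale.
Qed.

Lemma Cmod_le_sum (w : C) : (Cmod w <= Rabs (Re w) + Rabs (Im w))%R.
Proof.
  replace w with (RtoC (Re w) + Ci * RtoC (Im w)) at 1.
  - eapply Rle_trans; [apply Cmod_triangle|].
    rewrite Cmod_mult, Cmod_Ci, !Cmod_R. lra.
  - destruct w as [a b]; unfold Re, Im, Ci, RtoC, Cplus, Cmult; simpl; f_equal; ring.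
Qed.

Lemma is_C_derive_of_partials (U : C -> Prop) (f g : C -> C) :
  @open C_UniformSpace U ->
  (forall z, U z ->
    @continuous C_UniformSpace R_UniformSpace (fun z => Re (g z)) z /\
    @continuous C_UniformSpace R_UniformSpace (fun z => Im (g z)) z) ->
  (forall z, U z ->
   (is_derive (fun t : R => Re (f (t, snd z))) (fst z) (Re (g z)) /\
    is_derive (fun t : R => Im (f (t, snd z))) (fst z) (Im (g z))) /\
   (is_derive (fun t : R => Re (f (fst z, t))) (snd z) (- Im (g z))%R /\
    is_derive (fun t : R => Im (f (fst z, t))) (snd z) (Re (g z)))) ->
  forall z, U z -> @is_derive C_AbsRing C_NormedModule f z (g z).
Proof.
  intros oU Hc Hp [x y] Uz.
  destruct (Hp _ Uz) as [[Hx1 Hx2] [Hy1 Hy2]]. destruct (Hc _ Uz) as [c1 c2].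
  assert (lU : locally (x, y) U) by exact (oU _ Uz).
  assert (D1 : differentiable_pt_lim (fun a b => Re (f (a, b))) x y
            (Re (g (x, y))) (- Im (g (x, y)))%R).
  { apply filterdiff_differentiable_pt_lim.
    apply (is_derive_filterdiff (fun a b => Re (f (a, b))) x y
             (fun a b => Re (g (a, b)))).
    - apply filter_imp with (2 := lU). intros [a b] Vz. apply (Hp (a, b) Vz).
    - exact Hy1.
    - apply (@continuous_ext C_UniformSpace R_UniformSpace (fun z => Re (g z)));
        [intros [? ?]; reflexivity | exact c1]. }
  assert (D2 : differentiable_pt_lim (fun a b => Im (f (a, b))) x y
            (Im (g (x, y))) (Re (g (x, y)))).
  { apply filterdiff_differentiable_pt_lim.
    apply (is_derive_filterdiff (fun a b => Im (f (a, b))) x y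
             (fun a b => Im (g (a, b)))).
    - apply filter_imp with (2 := lU). intros [a b] Vz. apply (Hp (a, b) Vz).
    - exact Hy2.
    - apply (@continuous_ext C_UniformSpace R_UniformSpace (fun z => Im (g z)));
        [intros [? ?]; reflexivity | exact c2]. }
  split; [apply is_linear_scal_l|].
  intros z Hz. 
  assert (Ez := @is_filter_lim_locally_unique C_AbsRing (AbsRing_NormedModule C_AbsRing) _ _ Hz).
  subst z. intros e.
  assert (e2 : (0 < e / 2)%R) by (destruct e; simpl; lra).
  specialize (D1 (mkposreal _ e2)). specialize (D2 (mkposreal _ e2)).
  apply locally_2d_locally in D1. apply locally_2d_locally in D2.
  apply (proj1 (locally_C (x, y) _)).
  generalize (filter_and _ _ D1 D2). apply filter_imp. intros [a b] [H1 H2].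
  cbv beta in H1, H2. simpl fst in H1, H2; simpl snd in H1, H2. simpl pos in H1, H2.
  change (Cmod ((f (a, b) - f (x, y)) - ((a, b) - (x, y)) * g (x, y))%C
            <= e * Cmod ((a, b) - (x, y))%C)%R.
  assert (M : (Rmax (Rabs (a - x)) (Rabs (b - y)) <= Cmod ((a, b) - (x, y))%C)%R)
    by exact (Rmax_Cmod ((a, b) - (x, y))).
  eapply Rle_trans; [apply Cmod_le_sum|].
  match type of H1 with (Rabs ?u <= _)%R =>
    replace (Re (f (a, b) - f (x, y) - ((a, b) - (x, y)) * g (x, y))) with u end.
  2: { unfold Re, Im, Cminus, Cplus, Copp, Cmult; simpl; ring. }
  match type of H2 with (Rabs ?u <= _)%R =>
    replace (Im (f (a, b) - f (x, y) - ((a, b) - (x, y)) * g (x, y))) with u end.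
  2: { unfold Re, Im, Cminus, Cplus, Copp, Cmult; simpl; ring. }
  assert (e / 2 * Rmax (Rabs (a - x)) (Rabs (b - y)) <= e / 2 * Cmod ((a, b) - (x, y)))%R
    by (apply Rmult_le_compat_l; lra).
  lra.
Qed.

(** The branch of [w ^ s] on the right half-plane with value 1 at 1. *)
Definition half_plane (w : C) : Prop := (0 < Re w)%R.
Definition Cexp_polar (a b : R) : C := ((exp a * cos b)%R, (exp a * sin b)%R).
Definition Clog (w : C) : R * R :=
  ((ln (fst w ^ 2 + snd w ^ 2) / 2)%R, atan (snd w / fst w)).
Definition Croot (s : R) (w : C) : C :=
  Cexp_polar (s * fst (Clog w)) (s * snd (Clog w)).

Lemma Cexp_polar_add a b a' b' :
  Cexp_polar (a + a') (b + b') = Cexp_polar a b * Cexp_polar a' b'.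
Proof.
  unfold Cexp_polar, Cmult; simpl. rewrite exp_plus, cos_plus, sin_plus.
  f_equal; ring.
Qed.

Lemma Cexp_polar_0 : Cexp_polar 0 0 = 1.
Proof. unfold Cexp_polar; rewrite exp_0, cos_0, sin_0. unfold RtoC; f_equal; ring. Qed.

Lemma Cexp_polar_pow a b k :
  Cexp_polar a b ^ k = Cexp_polar (INR k * a) (INR k * b).
Proof.
  induction k as [|k IH].
  - simpl Cpow. simpl INR. rewrite !Rmult_0_l. symmetry; apply Cexp_polar_0.
  - rewrite Cpow_S, IH, <- Cexp_polar_add, S_INR. f_equal; ring.
Qed.

Lemma Cexp_polar_log w : half_plane w -> Cexp_polar (fst (Clog w)) (snd (Clog w)) = w.
Proof.
  destruct w as [x y]; unfold half_plane, Re; cbn [fst]; intros hx.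
  unfold Cexp_polar, Clog; cbn [fst snd].
  assert (p : (0 < x ^ 2 + y ^ 2)%R) by nra.
  assert (E : exp (ln (x ^ 2 + y ^ 2) / 2) = sqrt (x ^ 2 + y ^ 2)).
  { rewrite <- (Rpower_sqrt _ p). unfold Rpower. f_equal. field. }
  rewrite E.
  assert (r : (0 < 1 + (y / x)²)%R)
    by (assert (0 <= (y / x)²)%R by (apply Rle_0_sqr); lra).
  assert (q : (0 < sqrt (1 + (y / x)²))%R) by now apply sqrt_lt_R0.
  assert (Q : sqrt (x ^ 2 + y ^ 2) = (x * sqrt (1 + (y / x)²))%R).
  { apply sqrt_lem_1; [lra | apply Rmult_le_pos; lra |].
    replace (x * sqrt (1 + (y / x)²) * (x * sqrt (1 + (y / x)²)))%R
      with (x * x * (sqrt (1 + (y / x)²) * sqrt (1 + (y / x)²)))%R by ring.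
    rewrite sqrt_sqrt by lra. unfold Rsqr; field; lra. }
  rewrite cos_atan, sin_atan, Q. f_equal; field; repeat split; lra.
Qed.

Lemma Croot_pow s w k : Croot s w ^ k = Croot (INR k * s) w.
Proof. unfold Croot. rewrite Cexp_polar_pow. f_equal; ring. Qed.

Lemma Croot_add s t w : Croot (s + t) w = Croot s w * Croot t w.
Proof. unfold Croot. rewrite <- Cexp_polar_add. f_equal; ring. Qed.

Lemma Croot_1 w : half_plane w -> Croot 1 w = w.
Proof.
  intros h. unfold Croot. rewrite !Rmult_1_l. now apply Cexp_polar_log.
Qed.

Lemma Croot_at_1 s : Croot s 1 = 1.
Proof.
  unfold Croot, Clog, RtoC; cbn [fst snd].
  replace (1 ^ 2 + 0 ^ 2)%R with 1%R by ring. rewrite ln_1.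
  replace (0 / 1)%R with 0%R by field. rewrite atan_0.
  replace (s * (0 / 2))%R with 0%R by field. rewrite Rmult_0_r. apply Cexp_polar_0.
Qed.

Lemma open_half_plane : @open C_UniformSpace half_plane.
Proof.
  apply (@open_comp C_UniformSpace R_UniformSpace (fun w => fst w) (fun r => (0 < r)%R)).
  - intros [x y] _; apply @continuous_fst.
  - apply open_gt.
Qed.

Lemma half_plane_neq0 w : half_plane w -> w <> 0.
Proof. intros h ->; unfold half_plane, Re in h; simpl in h; lra. Qed.

Lemma Croot_continuous s w : half_plane w ->
  @continuous C_UniformSpace R_UniformSpace (fun w => Re (Croot s w)) w /\
  @continuous C_UniformSpace R_UniformSpace (fun w => Im (Croot s w)) w.
Proof.
  destruct w as [x y]; unfold half_plane, Re at 1; cbn [fst]; intros hx.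
  assert (p : (0 < x ^ 2 + y ^ 2)%R) by nra.
  assert (A : continuity_2d_pt (fun x y => s * (ln (x ^ 2 + y ^ 2) / 2))%R x y).
  { apply (continuity_1d_2d_pt_comp (fun r => s * (ln r / 2))%R (fun x y => x ^ 2 + y ^ 2)%R).
    - apply derivable_continuous_pt, ex_derive_Reals_0. auto_derive; auto.
    - apply continuity_2d_pt_plus; simpl; apply continuity_2d_pt_mult; try apply continuity_2d_pt_id1;
        try apply continuity_2d_pt_id2; apply continuity_2d_pt_mult;
          try apply continuity_2d_pt_id1; try apply continuity_2d_pt_id2; apply continuity_2d_pt_const. }
  assert (B : continuity_2d_pt (fun x y => s * atan (y / x))%R x y).
  { apply (continuity_1d_2d_pt_comp (fun r => s * atan r)%R (fun x y => y / x)%R).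
    - apply derivable_continuous_pt, ex_derive_Reals_0. auto_derive; auto.
    - apply continuity_2d_pt_mult; [apply continuity_2d_pt_id2|].
      apply continuity_2d_pt_inv; [apply continuity_2d_pt_id1 | lra]. }
  assert (Ae := continuity_1d_2d_pt_comp exp _ x y
     (derivable_continuous_pt _ _ (derivable_pt_exp _)) A).
  assert (Bc := continuity_1d_2d_pt_comp cos _ x y (continuity_cos _) B).
  assert (Bs := continuity_1d_2d_pt_comp sin _ x y (continuity_sin _) B).
  split.
  - exact (proj1 (continuity_2d_pt_filterlim _ x y) (continuity_2d_pt_mult _ _ x y Ae Bc)).
  - exact (proj1 (continuity_2d_pt_filterlim _ x y) (continuity_2d_pt_mult _ _ x y Ae Bs)).
Qed.

Lemma is_derive_Croot s w : half_plane w ->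
  @is_derive C_AbsRing C_NormedModule (Croot s) w (s * (Croot s w / w)).
Proof.
  revert w. apply (is_C_derive_of_partials half_plane); [apply open_half_plane | |].
  - intros w hw. destruct (Croot_continuous s w hw) as [c1 c2].
    assert (H : class_C 0 half_plane (fun w => s * (Croot s w * / w))).
    { apply class_C_mult; [apply class_C_const|]. apply class_C_mult.
      - split; (split; [|exact I]); intros z hz; apply (Croot_continuous s z hz).
      - apply class_C_inv; [apply half_plane_neq0 | apply class_C_id]. }
    destruct H as [[H1 _] [H2 _]]; split; [exact (H1 w hw) | exact (H2 w hw)].
  - intros [x y] hw. unfold half_plane, Re in hw; simpl in hw.
    assert (p : (0 < x ^ 2 + y ^ 2)%R) by nra.
    unfold Croot, Cexp_polar, Clog, Cdiv, Cinv, Re, Im, Cmult, RtoC; cbn [fst snd].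
    assert (q : (x * x + y * y <> 0)%R) by nra.
    split; split; auto_derive;
      try (simpl in p |- *; lra); try (split; [|split]; simpl in p; auto; lra);
      unfold Rdiv; cbn [pow];
      generalize (exp (s * (ln (x * (x * 1) + y * (y * 1)) * / 2)))
        (cos (s * atan (y * / x))) (sin (s * atan (y * / x))); intros e c d;
      field; repeat split; try lra; intros E; apply q; nra.
Qed.

Lemma local_root (n m : nat) (a b : C) : (1 <= n)%nat -> (1 <= m)%nat -> a <> 0 ->
  a ^ n * b ^ m = 1 ->
  exists (W : C -> Prop) (f : C -> C), @open C_UniformSpace W /\ W a /\ f a = b /\
    holomorphic_on W f /\
    forall z, W z -> C_derive f z <> 0 /\ z <> 0 /\ f z <> 0 /\ z ^ n * f z ^ m = 1.
Proof.
  intros n1 m1 a0 ab.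
  set (s := (- INR n / INR m)%R).
  set (W := fun z : C => half_plane (z * / a)).
  set (f := fun z : C => Croot s (z * / a) * b).
  assert (nR : (1 <= INR n)%R) by now apply (le_INR 1).
  assert (mR : (1 <= INR m)%R) by now apply (le_INR 1).
  assert (s0 : RtoC s <> 0).
  { intros E; apply RtoC_inj in E.
    assert (INR n = - (s * INR m))%R by (unfold s; field; lra). nra. }
  assert (Wz : forall z, W z -> z <> 0).
  { intros z hz ->; apply (half_plane_neq0 _ hz); ring. }
  assert (eqn : forall z, W z -> z ^ n * f z ^ m = 1).
  { intros z hz. unfold f. rewrite Cpow_mult_l, Croot_pow.
    replace z with (z * / a * a) at 1 by (field; exact a0).
    rewrite Cpow_mult_l. rewrite <- (Croot_1 _ hz) at 1. rewrite Croot_pow.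
    transitivity (Croot (INR n * 1 + INR m * s) (z * / a) * (a ^ n * b ^ m)).
    - rewrite Croot_add; ring.
    - rewrite ab. replace (INR n * 1 + INR m * s)%R with 0%R by (unfold s; field; lra).
      unfold Croot; rewrite !Rmult_0_l, Cexp_polar_0; ring. }
  assert (fz : forall z, W z -> f z <> 0).
  { intros z hz E. generalize (eqn z hz). rewrite E. destruct m as [|m']; [lia|].
    rewrite Cpow_S, Cmult_0_l, Cmult_0_r. intros H; apply RtoC_inj in H; lra. }
  assert (D : forall z, W z -> @is_derive C_AbsRing C_NormedModule f z (s * (f z * / z))).
  { intros z hz. unfold f.
    replace (s * (Croot s (z * / a) * b * / z))
      with (/ a * (s * (Croot s (z * / a) / (z * / a))) * b)
      by (field; auto).
    apply (is_C_derive_comp (fun w => w * b) (fun z => Croot s (z * / a)));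
      [apply is_C_derive_scale|].
    apply (is_C_derive_comp (Croot s) (fun z => z * / a)).
    - now apply is_derive_Croot.
    - apply is_C_derive_scale. }
  exists W, f. split; [|split; [|split; [|split]]].
  - apply (@open_comp C_UniformSpace C_UniformSpace (fun z => z * / a) half_plane).
    + intros z _. apply continuous_scale.
    + apply open_half_plane.
  - unfold W. replace (a * / a) with (RtoC 1) by (field; exact a0).
    unfold half_plane, Re; simpl; lra.
  - unfold f. replace (a * / a) with (RtoC 1) by (field; exact a0).
    rewrite Croot_at_1; ring.
  - split; [|intros z hz; eexists; apply (D z hz)].
    apply (smooth_on_of_derive W f (fun z => s * (f z * / z)) D).
    intros k Hk. apply class_C_mult; [apply class_C_const|].
    apply class_C_mult; [exact Hk|]. apply class_C_inv; [exact Wz | apply class_C_id].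
  - intros z hz. split; [|split; [|split]]; auto.
    rewrite (is_C_derive_unique f z _ (D z hz)).
    apply Cmult_neq_0; [exact s0|]. apply Cmult_neq_0; [now apply fz|].
    intros E. apply C1_nz. rewrite <- (Cinv_r z (Wz z hz)), E; ring.
Qed.

Inductive pole : Type := cone_zero | cone_infinity.

(** The underlying space is the Riemann sphere, [None] being the point at infinity.
    The cone points are 0, of order [n], and infinity, of order [m]. *)
Definition orbisphere_proj (n m : nat) (i : pole) (z : C) : option C :=
  match i with
  | cone_zero => Some (z ^ n)
  | cone_infinity => if Ceq_dec z 0 then None else Some (/ z ^ m)
  end.

(** With radius 2 the images [|w| < 2 ^ n] and [|w| > 2 ^ - m] of the two disks
    cover the sphere. *)
Definition orbisphere_atlas (n m : nat) : atlas :=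
  {| space := option C;
     chart := pole;
     radius := fun _ => 2;
     order := fun i => match i with cone_zero => n | cone_infinity => m end;
     proj := orbisphere_proj n m |}.

Lemma cos_sin_pow t k : ((cos t, sin t) : C) ^ k = (cos (INR k * t), sin (INR k * t)).
Proof.
  induction k as [|k IH].
  - simpl Cpow; simpl INR; rewrite Rmult_0_l, cos_0, sin_0; reflexivity.
  - rewrite Cpow_S, IH, S_INR. unfold Cmult; cbn [fst snd].
    replace ((INR k + 1) * t)%R with (t + INR k * t)%R by ring.
    rewrite cos_plus, sin_plus. f_equal; ring.
Qed.

Lemma rotation_pow k : (1 <= k)%nat -> rotation k ^ k = 1.
Proof.
  intros k1. assert (1 <= INR k)%R by now apply (le_INR 1).
  unfold rotation; rewrite cos_sin_pow.
  replace (INR k * (2 * PI / INR k))%R with (2 * PI)%R by (field; lra).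
  now rewrite cos_2PI, sin_2PI.
Qed.

Lemma unit_angle x y : (x * x + y * y = 1)%R ->
  exists t, (0 <= t)%R /\ cos t = x /\ sin t = y.
Proof.
  intros xy.
  assert (b : (-1 <= x <= 1)%R) by nra.
    assert (S2 : (sqrt (1 - x²) = Rabs y)%R).
    { rewrite <- sqrt_Rsqr_abs. f_equal. unfold Rsqr; lra. }
    destruct (Rle_dec 0 y) as [h|h].
    - exists (acos x). split; [apply acos_bound|]. split; [now apply cos_acos|].
      rewrite sin_acos by exact b. rewrite S2. now apply Rabs_pos_eq.
    - exists (2 * PI - acos x)%R. split; [generalize (acos_bound x) PI_RGT_0; lra|].
      unfold Rminus. rewrite cos_plus, sin_plus, cos_2PI, sin_2PI, cos_neg, sin_neg.
      rewrite cos_acos by exact b. rewrite sin_acos by exact b. rewrite S2.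
      rewrite Rabs_left by lra. split; ring.
Qed.

Lemma root_of_unity k (t : C) : (1 <= k)%nat -> t ^ k = 1 -> exists j, t = rotation k ^ j.
Proof.
  intros k1 E. assert (kR : (1 <= INR k)%R) by now apply (le_INR 1).
  assert (N : Cmod t = 1%R).
  { assert (P : (Cmod t ^ k = 1)%R) by (rewrite <- Cmod_pow, E; apply Cmod_1).
    destruct (pow_R1 _ _ P) as [Q|Q]; [|lia].
    rewrite Rabs_pos_eq in Q; [exact Q | apply Cmod_ge_0]. }
  destruct t as [x y]. unfold Cmod in N; cbn [fst snd] in N.
  assert (xy : (x * x + y * y = 1)%R).
  { rewrite <- (Rmult_1_l 1), <- N. rewrite sqrt_sqrt; [ring | nra]. }
  assert (A := unit_angle x y xy).
  destruct A as (t & t0 & <- & <-).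
  rewrite cos_sin_pow in E. unfold RtoC in E. apply (f_equal fst) in E; cbn [fst] in E.
  assert (S0 : sin (INR k * t / 2) = 0%R).
  { replace (INR k * t)%R with (2 * (INR k * t / 2))%R in E by field.
    rewrite cos_2a_sin in E. nra. }
  destruct (sin_eq_0_0 _ S0) as [z Hz].
  assert (z0 : (0 <= z)%Z).
  { apply le_IZR. assert (0 <= IZR z * PI)%R by nra. generalize PI_RGT_0; intros. nra. }
  exists (Z.to_nat z). unfold rotation. rewrite cos_sin_pow.
  rewrite INR_IZR_INZ, Z2Nat.id by exact z0.
  replace (IZR z * (2 * PI / INR k))%R with t; [reflexivity|].
  apply (Rmult_eq_reg_l (INR k)); [|lra].
  replace (INR k * (IZR z * (2 * PI / INR k)))%R with (2 * (IZR z * PI))%R by (field; lra).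
  rewrite <- Hz. field.
Qed.

Lemma rotation_orbit k z w : (1 <= k)%nat ->
  (z ^ k = w ^ k <-> exists j, w = rotation k ^ j * z).
Proof.
  intros k1. destruct (Ceq_dec z 0) as [->|z0].
  - split.
    + intros E. exists 0%nat. destruct (Ceq_dec w 0) as [->|w0]; [ring|].
      destruct (Cpow_nz w k w0). rewrite <- E.
      destruct k; [lia|]. rewrite Cpow_S; ring.
    + intros [j ->]. now rewrite Cmult_0_r.
  - split.
    + intros E. destruct (root_of_unity k (w * / z) k1) as [j Hj].
      * rewrite Cpow_mult_l, Cpow_inv, <- E by exact z0. apply Cinv_r. now apply Cpow_nz.
      * exists j. rewrite <- Hj. field; exact z0.
    + intros [j ->]. rewrite Cpow_mult_l, <- Cpow_mult_r, Nat.mul_comm, Cpow_mult_r.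
      rewrite rotation_pow by exact k1. rewrite Cpow_1_l. ring.
Qed.

Lemma scale_change (X : atlas) (i : chart X) (c : C) : Cmod c = 1%R ->
  (forall z, dom X i z -> proj X i (z * c) = proj X i z) ->
  exists p : change X i i, (forall z, source p z <-> dom X i z) /\ (forall z, p z = z * c).
Proof.
  intros c1 Hc.
  assert (c0 : c <> 0).
  { intros ->. rewrite Cmod_0 in c1; lra. }
  unshelve eexists (Change X i i (dom X i) (fun z => z * c) _ _ _ _ _ _);
    [ apply open_disk | auto | | | | exact Hc | split; [intros z; simpl; tauto | reflexivity] ].
  - intros z Hz. unfold dom. rewrite Cmod_mult, c1, Rmult_1_r. exact Hz.
  - split.
    + apply smooth_on_mult; [intros k; apply class_C_id | apply smooth_on_const].
    + intros z _. exists c. apply is_C_derive_scale.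
  - intros z _. rewrite (is_C_derive_unique _ z c); [exact c0 | apply is_C_derive_scale].
Qed.

(** Stereographic coordinates. *)
Definition sphere_coord (k : nat) (p : option C) : R :=
  match p with
  | None => match k with 0%nat | 1%nat => 0 | _ => -1 end
  | Some z =>
    (match k with
     | 0%nat => 2 * Re z
     | 1%nat => 2 * Im z
     | _ => 1 - (Re z ^ 2 + Im z ^ 2)
     end * / (1 + (Re z ^ 2 + Im z ^ 2)))%R
  end.

Lemma sphere_coord_inj p q : (forall k, (k <= 2)%nat -> sphere_coord k p = sphere_coord k q) ->
  p = q.
Proof.
  assert (P : forall z : C, (0 < 1 + (Re z ^ 2 + Im z ^ 2))%R).
  { intros z. generalize (pow2_ge_0 (Re z)) (pow2_ge_0 (Im z)); lra. }
  assert (Q : forall z : C, sphere_coord 2 (Some z) = (2 * / (1 + (Re z ^ 2 + Im z ^ 2)) - 1)%R).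
  { intros z. generalize (P z); intros; simpl sphere_coord; field; lra. }
  assert (Q0 : forall z : C, (0 < / (1 + (Re z ^ 2 + Im z ^ 2)))%R)
    by (intros z; apply Rinv_0_lt_compat, P).
  intros H. assert (H0 := H 0%nat ltac:(lia)). assert (H1 := H 1%nat ltac:(lia)).
  assert (H2 := H 2%nat ltac:(lia)). clear H.
  destruct p as [z|], q as [w|]; auto.
  - rewrite !Q in H2.
    assert (E : (/ (1 + (Re z ^ 2 + Im z ^ 2)) = / (1 + (Re w ^ 2 + Im w ^ 2)))%R) by lra.
    cbv beta iota delta [sphere_coord] in H0, H1. rewrite E in H0, H1.
    generalize (Q0 w); intros q.
    f_equal. apply injective_projections.
    + change (Re z = Re w). nra.
    + change (Im z = Im w). nra.
  - rewrite Q in H2. generalize (Q0 z). simpl sphere_coord in H2. lra.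
  - rewrite Q in H2. generalize (Q0 w). simpl sphere_coord in H2. lra.
Qed.

Lemma class_C_pow k U n : class_C k U (fun z => z ^ n).
Proof.
  induction n as [|n IH]; [exact (class_C_const k U 1)|].
  apply (class_C_mult k U (fun z => z) (fun z => z ^ n)); [apply class_C_id | exact IH].
Qed.

Definition everywhere (z : C) : Prop := True.

Lemma sphere_coord_continuous n m k i z : (1 <= m)%nat ->
  @continuous C_UniformSpace R_UniformSpace
    (fun z => sphere_coord k (orbisphere_proj n m i z)) z.
Proof.
  intros m1.
  assert (P : forall z : C, (1 + (Re z ^ 2 + Im z ^ 2) <> 0)%R).
  { intros w. generalize (pow2_ge_0 (Re w)) (pow2_ge_0 (Im w)); lra. }
  assert (G : forall (j : nat) (f g : C -> R), 
     real_class 0 everywhere f ->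
     (forall z, g z = (f z * / (1 + (Re (z ^ j) ^ 2 + Im (z ^ j) ^ 2)))%R) ->
     @continuous C_UniformSpace R_UniformSpace g z).
  { intros j f g Hf E.
    apply (@continuous_ext C_UniformSpace R_UniformSpace
       (fun z => (f z * / (1 + (Re (z ^ j) ^ 2 + Im (z ^ j) ^ 2)))%R)); [now intros|].
    destruct (class_C_pow 0 everywhere j) as [p1 p2].
    apply (real_class_mult 0 everywhere _ _ Hf) with (z := z); [|exact I].
    apply real_class_inv; [intros; apply P|].
    apply real_class_plus; [apply real_class_const|].
    apply real_class_plus; now apply real_class_sqr. }
  assert (Z0 : forall z : C, (z <> 0 -> 0 < Re z ^ 2 + Im z ^ 2)%R).
  { intros [x y] h. unfold Re, Im; cbn [fst snd].
    destruct (Req_dec x 0) as [->|]; [|nra].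
    destruct (Req_dec y 0) as [->|]; [|nra]. now destruct h. }
  destruct i.
  - destruct (class_C_pow 0 everywhere n) as [p1 p2].
    destruct k as [|[|k]].
    + apply (G n (fun z => 2 * Re (z ^ n))%R); [|reflexivity].
      apply real_class_mult; [apply real_class_const | exact p1].
    + apply (G n (fun z => 2 * Im (z ^ n))%R); [|reflexivity].
      apply real_class_mult; [apply real_class_const | exact p2].
    + apply (G n (fun z => 1 + - (Re (z ^ n) ^ 2 + Im (z ^ n) ^ 2))%R); [|reflexivity].
      apply real_class_plus; [apply real_class_const|].
      apply real_class_opp, real_class_plus; now apply real_class_sqr.
  - destruct (class_C_pow 0 everywhere m) as [p1 p2].
    assert (m0 : (0 : C) ^ m = 0) by (destruct m; [lia | rewrite Cpow_S; ring]).
    assert (I1 : forall z : C, Re (/ z) = (Re z / (Re z ^ 2 + Im z ^ 2))%R) by reflexivity.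
    assert (I2 : forall z : C, Im (/ z) = (- Im z / (Re z ^ 2 + Im z ^ 2))%R) by reflexivity.
    destruct k as [|[|k]].
    + apply (G m (fun z => 2 * Re (z ^ m))%R).
      * apply real_class_mult; [apply real_class_const | exact p1].
      * intros y. unfold orbisphere_proj. destruct (Ceq_dec y 0) as [->|y0].
        -- rewrite m0. unfold sphere_coord, Re, Im; simpl. field.
        -- cbv beta iota delta [sphere_coord]. rewrite I1, I2.
           generalize (Z0 _ (Cpow_nz y m y0)) (P (y ^ m)); intros. field. split; nra.
    + apply (G m (fun z => - (2 * Im (z ^ m)))%R).
      * apply real_class_opp, real_class_mult; [apply real_class_const | exact p2].
      * intros y. unfold orbisphere_proj. destruct (Ceq_dec y 0) as [->|y0].
        -- rewrite m0. unfold sphere_coord, Re, Im; simpl. field.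
        -- cbv beta iota delta [sphere_coord]. rewrite I1, I2.
           generalize (Z0 _ (Cpow_nz y m y0)) (P (y ^ m)); intros. field. split; nra.
    + apply (G m (fun z => (Re (z ^ m) ^ 2 + Im (z ^ m) ^ 2) + -1)%R).
      * apply real_class_plus; [|apply real_class_const].
        apply real_class_plus; now apply real_class_sqr.
      * intros y. unfold orbisphere_proj. destruct (Ceq_dec y 0) as [->|y0].
        -- rewrite m0. unfold sphere_coord, Re, Im; simpl. field.
        -- cbv beta iota delta [sphere_coord]. rewrite I1, I2.
           generalize (Z0 _ (Cpow_nz y m y0)) (P (y ^ m)); intros. field. split; nra.
Qed.

Lemma orbisphere_hausdorff n m (p q : option C) : (1 <= m)%nat -> p <> q ->
  exists A B : option C -> Prop,
    open_in (orbisphere_atlas n m) A /\ open_in (orbisphere_atlas n m) B /\ A p /\ B q /\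
    forall r, A r -> B r -> False.
Proof.
  intros m1.
  assert (G : forall k p q, (sphere_coord k p < sphere_coord k q)%R ->
    exists A B : option C -> Prop,
    open_in (orbisphere_atlas n m) A /\ open_in (orbisphere_atlas n m) B /\ A p /\ B q /\
    forall r, A r -> B r -> False).
  { clear p q; intros k p q lt. set (c := ((sphere_coord k p + sphere_coord k q) / 2)%R).
    exists (fun r => sphere_coord k r < c)%R, (fun r => c < sphere_coord k r)%R.
    split; [|split; [|split; [|split]]]; try (unfold c; lra); [| |intros; lra].
    - intros i. apply open_and; [apply open_disk|].
      apply (@open_comp C_UniformSpace R_UniformSpace
        (fun z => sphere_coord k (orbisphere_proj n m i z)) (fun x => x < c)%R);
        [|apply open_lt].
      intros z _. now apply sphere_coord_continuous.
    - intros i. apply open_and; [apply open_disk|].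
      apply (@open_comp C_UniformSpace R_UniformSpace
        (fun z => sphere_coord k (orbisphere_proj n m i z)) (fun x => c < x)%R);
        [|apply open_gt].
      intros z _. now apply sphere_coord_continuous. }
  intros pq.
  assert (N : ~ forall k, (k <= 2)%nat -> sphere_coord k p = sphere_coord k q)
    by (intros H; apply pq, sphere_coord_inj, H).
  assert (T : forall k, sphere_coord k p = sphere_coord k q \/
    exists A B : option C -> Prop,
    open_in (orbisphere_atlas n m) A /\ open_in (orbisphere_atlas n m) B /\ A p /\ B q /\
    forall r, A r -> B r -> False).
  { intros k. destruct (Rtotal_order (sphere_coord k p) (sphere_coord k q)) as [H|[H|H]].
    - right. exact (G k p q H).
    - now left.
    - right. destruct (G k q p H) as (A & B & oA & oB & Aq & Bp & D).
      exists B, A. repeat split; auto. intros r HB HA; exact (D r HA HB). }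
  destruct (T 0%nat) as [E0|]; [|assumption].
  destruct (T 1%nat) as [E1|]; [|assumption].
  destruct (T 2%nat) as [E2|]; [|assumption].
  destruct N. intros [|[|[|k]]] hk; auto; lia.
Qed.

Lemma Some_inj (A : Type) (x y : A) : Some x = Some y -> x = y.
Proof. now intros [= ->]. Qed.

Lemma root_change n m (i j : pole) (N M : nat) (z w : C) :
  (1 <= N)%nat -> (1 <= M)%nat -> z <> 0 -> z ^ N * w ^ M = 1 ->
  (forall x y : C, x <> 0 -> y <> 0 -> x ^ N * y ^ M = 1 ->
     orbisphere_proj n m j y = orbisphere_proj n m i x) ->
  dom (orbisphere_atlas n m) i z -> dom (orbisphere_atlas n m) j w ->
  exists p : change (orbisphere_atlas n m) i j, source p z /\ p z = w.
Proof.
  intros N1 M1 z0 E Hp Dz Dw.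
  destruct (local_root N M z w N1 M1 z0 E) as (W & f & oW & Wz & fz & [hs hd] & H).
  set (S := fun x => (W x /\ (Cmod (f x) < 2)%R) /\ (Cmod x < 2)%R).
  unshelve eexists (Change (orbisphere_atlas n m) i j S f _ _ _ _ _ _).
  - apply open_and; [|apply open_disk].
    apply (open_preimage W (fun x => Cmod x < 2)%R f oW); [now split | apply open_disk].
  - intros x Sx. apply Sx.
  - intros x Sx. apply Sx.
  - split; [apply (smooth_on_sub W); [intros x Sx; apply Sx | exact hs]|].
    intros x Sx. apply hd, Sx.
  - intros x Sx. exact (proj1 (H x (proj1 (proj1 Sx)))).
  - intros x Sx. destruct (H x (proj1 (proj1 Sx))) as (_ & x0 & y0 & e).
    now apply Hp.
  - simpl. split; [|exact fz]. unfold S. rewrite fz. split; [split|]; assumption.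
Qed.

Lemma orbisphere_orbit n m (i : pole) (z w : C) : (1 <= n)%nat -> (1 <= m)%nat ->
  (orbisphere_proj n m i z = orbisphere_proj n m i w <->
   exists k, w = rotation (order (orbisphere_atlas n m) i) ^ k * z).
Proof.
  intros n1 m1. destruct i; simpl order.
  - rewrite <- (rotation_orbit n z w n1). simpl.
    split; [apply Some_inj | intros E; f_equal; exact E].
  - rewrite <- (rotation_orbit m z w m1). simpl.
    assert (m0 : (0 : C) ^ m = 0) by (destruct m; [lia | rewrite Cpow_S; ring]).
    destruct (Ceq_dec z 0) as [->|z0], (Ceq_dec w 0) as [->|w0].
    + tauto.
    + split; [discriminate|]. rewrite m0. intros E. destruct (Cpow_nz w m w0). now rewrite <- E.
    + split; [discriminate|]. rewrite m0. intros E. now destruct (Cpow_nz z m z0).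
    + split; [|intros ->; reflexivity].
      intros E. assert (F := Some_inj _ _ _ E).
      transitivity (/ / z ^ m); [field; now apply Cpow_nz|].
      rewrite F. field. now apply Cpow_nz.
Qed.

Lemma orbisphere_compatible n m i j z w : (1 <= n)%nat -> (1 <= m)%nat ->
  dom (orbisphere_atlas n m) i z -> dom (orbisphere_atlas n m) j w ->
  orbisphere_proj n m i z = orbisphere_proj n m j w ->
  exists p : change (orbisphere_atlas n m) i j, source p z /\ p z = w.
Proof.
  intros n1 m1 Dz Dw E.
  assert (same : i = j -> exists p : change (orbisphere_atlas n m) i j, source p z /\ p z = w).
  { intros <-. apply orbisphere_orbit in E; [|assumption..].
    destruct E as [k ->].
    destruct (scale_change (orbisphere_atlas n m) i
               (rotation (order (orbisphere_atlas n m) i) ^ k)) as (p & Hs & Hp).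
    - rewrite Cmod_pow. unfold rotation, Cmod; cbn [fst snd].
      match goal with |- context [sqrt ?u] => replace u with 1%R end;
        [now rewrite sqrt_1, pow1|].
      rewrite <- !Rsqr_pow2, Rplus_comm. symmetry; apply sin2_cos2.
    - intros x Dx. symmetry. apply orbisphere_orbit; auto. exists k. ring.
    - exists p. split; [now apply Hs | rewrite Hp; ring]. }
  destruct i, j; try (now apply same); simpl in E.
  - destruct (Ceq_dec w 0) as [|w0]; [discriminate|].
    assert (F : z ^ n = / w ^ m) by exact (Some_inj _ _ _ E).
    assert (e : z ^ n * w ^ m = 1) by (rewrite F; field; now apply Cpow_nz).
    apply (root_change n m cone_zero cone_infinity n m z w); auto.
    + intros ->. apply C1_nz. rewrite <- e. destruct n; [lia|]. rewrite Cpow_S; ring.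
    + intros x y x0 y0 xy. simpl. destruct (Ceq_dec y 0); [contradiction|].
      f_equal. rewrite <- (Cmult_1_l (/ y ^ m)), <- xy. field. now apply Cpow_nz.
  - destruct (Ceq_dec z 0) as [|z0]; [discriminate|].
    assert (F : w ^ n = / z ^ m) by exact (eq_sym (Some_inj _ _ _ E)).
    assert (e : z ^ m * w ^ n = 1) by (rewrite F; field; now apply Cpow_nz).
    apply (root_change n m cone_infinity cone_zero m n z w); auto.
    intros x y x0 y0 xy. simpl. destruct (Ceq_dec x 0); [contradiction|].
    f_equal. rewrite <- (Cmult_1_l (/ x ^ m)), <- xy. field. now apply Cpow_nz.
Qed.

Lemma complex_root k (z : C) : (1 <= k)%nat -> z <> 0 -> exists w, w ^ k = z.
Proof.
  intros k1 z0. assert (kR : (1 <= INR k)%R) by now apply (le_INR 1).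
  assert (r0 := proj1 (Cmod_gt_0 z) z0).
  assert (N : (Re z * Re z + Im z * Im z = Cmod z * Cmod z)%R).
  { unfold Cmod, Re, Im. rewrite sqrt_sqrt; [ring | nra]. }
  destruct (unit_angle (Re z / Cmod z) (Im z / Cmod z)) as (t & _ & ct & st).
  { transitivity ((Re z * Re z + Im z * Im z) / (Cmod z * Cmod z))%R; [field; lra|].
    rewrite N; field; lra. }
  exists (Cexp_polar (ln (Cmod z) / INR k) (t / INR k)).
  rewrite Cexp_polar_pow. unfold Cexp_polar.
  replace (INR k * (ln (Cmod z) / INR k))%R with (ln (Cmod z)) by (field; lra).
  replace (INR k * (t / INR k))%R with t by (field; lra).
  rewrite exp_ln, ct, st by exact r0. apply injective_projections; cbn [fst snd].
  - unfold Re; field; lra.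
  - unfold Im; field; lra.
Qed.

Lemma Cmod_lt_2 k (w : C) : (1 <= k)%nat -> (Cmod (w ^ k) <= 1)%R -> (Cmod w < 2)%R.
Proof.
  intros k1 H. apply Rnot_le_lt; intros h.
  rewrite Cmod_pow in H. assert (H2 := pow_incr 2 (Cmod w) k ltac:(lra)).
  assert (H3 := Rle_pow 2 1 k ltac:(lra) k1). lra.
Qed.

Lemma orbisphere_cover n m (p : option C) : (1 <= n)%nat -> (1 <= m)%nat ->
  exists i z, dom (orbisphere_atlas n m) i z /\ orbisphere_proj n m i z = p.
Proof.
  intros n1 m1. destruct p as [z|].
  - destruct (Ceq_dec z 0) as [->|z0].
    + exists cone_zero, 0. unfold dom; simpl. rewrite Cmod_0. split; [lra|].
      f_equal. destruct n; [lia|]. rewrite Cpow_S; ring.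
    + destruct (Rle_dec (Cmod z) 1) as [h|h].
      * destruct (complex_root n z n1 z0) as [w Hw].
        exists cone_zero, w. split; [|simpl; now rewrite Hw].
        apply (Cmod_lt_2 n); [exact n1 | now rewrite Hw].
      * assert (i0 : / z <> 0) by (intros E; apply C1_nz; rewrite <- (Cinv_r z z0), E; ring).
        destruct (complex_root m (/ z) m1 i0) as [w Hw].
        exists cone_infinity, w. split.
        -- apply (Cmod_lt_2 m); [exact m1|]. rewrite Hw, Cmod_inv by exact z0.
           rewrite <- Rinv_1. apply Rinv_le_contravar; lra.
        -- simpl. destruct (Ceq_dec w 0) as [->|w0].
           ++ exfalso. apply i0. rewrite <- Hw. destruct m; [lia|]. rewrite Cpow_S; ring.
           ++ f_equal. rewrite Hw. field. exact z0.
  - exists cone_infinity, 0. unfold dom; simpl. rewrite Cmod_0. split; [lra|].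
    destruct (Ceq_dec 0 0); [reflexivity | contradiction].
Qed.

Program Definition orbisphere (n m : nat) (hn : (2 <= n)%nat) (hm : (2 <= m)%nat) : orbifold :=
  {| orbifold_atlas := orbisphere_atlas n m |}.
Next Obligation. intros n m hn hm i. simpl. lra. Qed.
Next Obligation. intros n m hn hm [|]; simpl; lia. Qed.
Next Obligation. intros n m hn hm p. apply orbisphere_cover; lia. Qed.
Next Obligation. intros n m hn hm i z w _ _. apply orbisphere_orbit; lia. Qed.
Next Obligation. intros n m hn hm i j z w. apply orbisphere_compatible; lia. Qed.
Next Obligation.
  intros n m hn hm. exists (fun k => match k with O => cone_zero | _ => cone_infinity end).
  intros [|]; [now exists 0%nat | now exists 1%nat].
Qed.
Next Obligation. intros n m hn hm p q. apply orbisphere_hausdorff; lia. Qed.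

Definition half_form_bundle {X : orbifold} (delta : orbi_line_bundle X) : Prop :=
  isomorphic (tensor delta delta) (canonical X).

(* Main.v *)
Require Import Defs.
From Stdlib Require Import Arith Reals Lra Lia.
From Coquelicot Require Import Coquelicot.

Open Scope C_scope.

(** A square root [delta] of the canonical bundle gives, at a cone point of order
    [k], a [k]-th root of unity (the weight of the generator [c] on the fiber of
    [delta]) whose square is [/ c], and [c] generates the [k]-th roots of unity;
    for [k = 2 l] the [l]-th power of the square would be both [1] and
    [c ^ l = -1].

    Conversely let [n = 2 a + 1] and [m = 2 b + 1]. On the base with coordinate
    [w = z ^ n = / u ^ m] the form [dw] is [n z ^ (2 a) dz] in one chart and
    [- m u ^ (- 2 (b + 1)) du] in the other. Hence a bundle with a nowhere zero
    section equal to [z ^ a] and [u ^ - (b + 1)] in local frames away from the cone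
    points is a square root of the canonical bundle, up to the constants [n] and
    [- m]. *)

(** * The action of the local group on the fiber over a cone point *)

Lemma glue_id {X : orbifold} (L : orbi_line_bundle X) i (p : change X i i) z :
  (forall x, source p x -> p x = x) -> source p z -> glue L p z = 1.
Proof.
  intros Hp Sz.
  (* Since [p] composed with itself is [p], the cocycle condition makes this factor idempotent;
     being nonzero, it is 1. *)
  assert (E : glue L p z = glue L p z * glue L p z).
  { rewrite (glue_comp L p p p) at 1; [now rewrite (Hp z Sz) | | exact Sz].
    intros x Sx. now rewrite !(Hp x Sx). }
  assert (N := glue_neq0 L p z Sz).
  transitivity (glue L p z * glue L p z * / glue L p z); [|rewrite <- E]; field; exact N.
Qed.

Lemma Cmod_rotation k : Cmod (rotation k) = 1%R.
Proof.
  unfold Cmod, rotation; cbn [fst snd].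
  rewrite <- !Rsqr_pow2, Rplus_comm, sin2_cos2. apply sqrt_1.
Qed.

Lemma rotation_change (X : orbifold) (i : chart X) k :
  exists p : change X i i, (forall z, source p z <-> dom X i z) /\
    forall z, p z = z * rotation (order X i) ^ k.
Proof.
  assert (M : Cmod (rotation (order X i) ^ k) = 1%R)
    by now rewrite Cmod_pow, Cmod_rotation, pow1.
  apply scale_change; [exact M|].
  intros z Dz. symmetry. apply proj_orbit; [exact Dz | |exists k; ring].
  unfold dom. now rewrite Cmod_mult, M, Rmult_1_r.
Qed.

(** All rotations fix the center of the chart, so there the cocycle condition is multiplicative at a
    single point and the local group acts on that fiber by a character. *)
Lemma glue_rotation_pow {X : orbifold} (L : orbi_line_bundle X) i (p : change X i i) :
  (forall z, source p z <-> dom X i z) ->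
  (forall z, p z = z * rotation (order X i)) ->
  forall k (q : change X i i), (forall z, source q z <-> dom X i z) ->
    (forall z, q z = z * rotation (order X i) ^ k) ->
    glue L q 0 = glue L p 0 ^ k.
Proof.
  intros Sp Hp.
  assert (D0 : dom X i 0) by (unfold dom; rewrite Cmod_0; apply radius_pos).
  induction k as [|k IH]; intros q Sq Hq.
  - apply glue_id; [|now apply Sq]. intros x _. rewrite Hq. simpl. ring.
  - destruct (rotation_change X i k) as (r & Sr & Hr).
    rewrite (glue_comp L r p q), (IH r Sr Hr); [| |now apply Sq].
    + rewrite Hr, Cmult_0_l, Cpow_S. reflexivity.
    + intros z Hz. rewrite Sr, Sp. split; [now apply Sq|]. split.
      * apply target_dom, Sr. now apply Sq.
      * rewrite Hq, Hp, Hr, Cpow_S. ring.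
Qed.

Lemma rotation_double_pow k : (1 <= k)%nat -> rotation (2 * k) ^ k = -1.
Proof.
  intros k1. assert (1 <= INR k)%R by now apply (le_INR 1).
  unfold rotation. rewrite cos_sin_pow, mult_INR.
  replace (INR k * (2 * PI / (INR 2 * INR k)))%R with PI by (simpl; field; lra).
  now rewrite cos_PI, sin_PI.
Qed.

Lemma half_form_order_odd {X : orbifold} (delta : orbi_line_bundle X) (i : chart X) :
  half_form_bundle delta -> Nat.Odd (order X i).
Proof.
  intros (h & h0 & _ & H).
  destruct (Nat.Even_or_Odd (order X i)) as [[k Ek]|O]; [exfalso | exact O].
  assert (k1 : (1 <= k)%nat) by (generalize (order_pos X i); lia).
  destruct (rotation_change X i 1) as (p & Sp & Hp).
  (* The full power of the generator is the identity map, so its factor is 1 and [P] makes the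
     weight of the generator a root of unity. *)
  destruct (rotation_change X i (order X i)) as (q & Sq & Hq).
  rewrite Cpow_1_r in Hp.
  assert (D0 : dom X i 0) by (unfold dom; rewrite Cmod_0; apply radius_pos).
  assert (P := glue_rotation_pow delta i p Sp Hp _ q Sq Hq).
  rewrite glue_id in P; [| |now apply Sq].
  2: { intros x _. rewrite Hq, rotation_pow by apply order_pos. ring. }
  (* At the fixed point 0 both values of [h] are [h i 0] and cancel: the squared weight is the
     inverse of the derivative of [p]. *)
  assert (E := H i i p 0 (proj2 (Sp 0) D0)).
  rewrite Hp, Cmult_0_l in E. simpl in E.
  assert (Dp : C_derive p 0 = rotation (order X i)).
  { apply is_C_derive_unique.
    apply (@is_derive_ext C_AbsRing C_NormedModule (fun z => z * rotation (order X i))).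
    - intros; symmetry; apply Hp.
    - apply is_C_derive_scale. }
  rewrite Dp in E.
  assert (c0 : rotation (order X i) <> 0).
  { intros E0. generalize (Cmod_rotation (order X i)). rewrite E0, Cmod_0. lra. }
  assert (F : glue delta p 0 * glue delta p 0 * rotation (order X i) = 1).
  { transitivity (h i 0 * (glue delta p 0 * glue delta p 0) * rotation (order X i) / h i 0).
    - field. now apply h0.
    - rewrite E. field. split; [exact c0 | now apply h0]. }
  (* With order [2 * k], the [k]-th power turns the squared weight into 1 and the rotation into
     -1. *)
  apply (f_equal (fun x => x ^ k)) in F.
  rewrite Cpow_1_l, !Cpow_mult_l, <- Cpow_add_r in F.
  replace (k + k)%nat with (order X i) in F by lia.
  rewrite <- P, Ek, rotation_double_pow in F by exact k1.
  apply (f_equal fst) in F. simpl in F. lra.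
Qed.

(** * Complex derivatives and identities between powers *)

Lemma is_C_derive_mult (f g : C -> C) (z df dg : C) :
  @is_derive C_AbsRing C_NormedModule f z df ->
  @is_derive C_AbsRing C_NormedModule g z dg ->
  @is_derive C_AbsRing C_NormedModule (fun x => f x * g x) z (df * g z + f z * dg).
Proof.
  intros [_ Hf] [_ Hg].
  (* The general product rule speaks of [C] as a module over itself in another packaging; the
     estimate carries over, and only the linearity component is proved again. *)
  assert (H : @is_derive C_AbsRing (AbsRing_NormedModule C_AbsRing)
                (fun x => f x * g x) z (df * g z + f z * dg)).
  { apply (@is_derive_mult C_AbsRing f g z df dg).
    - split; [apply is_linear_scal_l | exact Hf].
    - split; [apply is_linear_scal_l | exact Hg].
    - exact Cmult_comm. }
  split; [apply is_linear_scal_l | exact (proj2 H)].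
Qed.

Lemma is_C_derive_pow (f : C -> C) (z df : C) k :
  @is_derive C_AbsRing C_NormedModule f z df ->
  @is_derive C_AbsRing C_NormedModule (fun x => f x ^ S k) z (INR (S k) * f z ^ k * df).
Proof.
  intros Hf. induction k as [|k IH].
  - apply (@is_derive_ext C_AbsRing C_NormedModule f); [intros; simpl; ring|].
    replace (INR 1 * f z ^ 0 * df) with df by (simpl; ring). exact Hf.
  - replace (INR (S (S k)) * f z ^ S k * df)
      with (df * f z ^ S k + f z * (INR (S k) * f z ^ k * df)).
    + exact (is_C_derive_mult f (fun x => f x ^ S k) z _ _ Hf IH).
    + rewrite (S_INR (S k)), RtoC_plus, (Cpow_S (f z) k). ring.
Qed.

Lemma is_C_derive_id (z : C) : @is_derive C_AbsRing C_NormedModule (fun x => x) z (RtoC 1).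
Proof.
  apply (@is_derive_ext C_AbsRing C_NormedModule (fun w => w * 1)).
  - intros t. apply Cmult_1_r.
  - apply is_C_derive_scale.
Qed.

Lemma is_C_derive_locally_eq (U : C -> Prop) (f g : C -> C) (z df dg : C) :
  @open C_UniformSpace U -> U z -> (forall x, U x -> f x = g x) ->
  @is_derive C_AbsRing C_NormedModule f z df ->
  @is_derive C_AbsRing C_NormedModule g z dg -> df = dg.
Proof.
  intros oU Uz E Hf Hg.
  rewrite <- (is_C_derive_unique g z dg Hg). symmetry. apply is_C_derive_unique.
  apply (@is_derive_ext_loc C_AbsRing C_NormedModule f); [|exact Hf].
  apply locally_C. apply filter_imp with (2 := oU z Uz). exact E.
Qed.

Lemma INR_S_C_neq0 k : RtoC (INR (S k)) <> 0.
Proof. intros E. apply RtoC_inj in E. generalize (pos_INR k). rewrite S_INR in E. lra. Qed.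

Lemma Cpow_eq0 (z : C) k : z ^ k = 0 -> z = 0.
Proof. intros E. destruct (Ceq_dec z 0) as [H|H]; [exact H|]. now destruct (Cpow_nz z k H). Qed.

(** Differentiating the identity gives [f z ^ (k - 1) * l = z ^ (k - 1)]; multiply by [f z] and
    divide by [z ^ (k - 1)]. At 0 the identity itself forces [f z = 0]. *)
Lemma derive_of_pow_eq (U : C -> Prop) (f : C -> C) (z l : C) k : (1 <= k)%nat ->
  @open C_UniformSpace U -> U z -> (forall x, U x -> f x ^ k = x ^ k) ->
  @is_derive C_AbsRing C_NormedModule f z l -> f z = l * z.
Proof.
  intros k1 oU Uz E Hf. destruct k as [|k]; [lia|].
  assert (Ez := E z Uz).
  destruct (Ceq_dec z 0) as [->|z0].
  - rewrite Cmult_0_r. apply (Cpow_eq0 _ (S k)). rewrite Ez, Cpow_S. ring.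
  - assert (D := is_C_derive_locally_eq U _ _ z _ _ oU Uz E
                   (is_C_derive_pow f z l k Hf)
                   (is_C_derive_pow (fun x => x) z 1 k (is_C_derive_id z))).
    assert (D' : f z ^ k * l = z ^ k).
    { transitivity (/ INR (S k) * (INR (S k) * f z ^ k * l)).
      - field. apply INR_S_C_neq0.
      - rewrite D. field. apply INR_S_C_neq0. }
    assert (zk := Cpow_nz z k z0).
    transitivity (f z * (f z ^ k * l) / z ^ k); [rewrite D'; field; exact zk|].
    transitivity (f z ^ S k * l / z ^ k); [rewrite Cpow_S; field; exact zk|].
    rewrite Ez, Cpow_S. field. exact zk.
Qed.

(** This is the logarithmic derivative [j / z + k * l / f z = 0] with denominators cleared. *)
Lemma derive_of_pow_mul_eq1 (U : C -> Prop) (f : C -> C) (z l : C) j k :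
  (1 <= j)%nat -> (1 <= k)%nat ->
  @open C_UniformSpace U -> U z -> (forall x, U x -> x ^ j * f x ^ k = 1) ->
  @is_derive C_AbsRing C_NormedModule f z l -> INR j * f z + INR k * z * l = 0.
Proof.
  intros j1 k1 oU Uz E Hf. destruct j as [|j]; [lia|]. destruct k as [|k]; [lia|].
  assert (Ez := E z Uz).
  assert (D := is_C_derive_locally_eq U _ _ z _ _ oU Uz E
                 (is_C_derive_mult _ _ z _ _
                   (is_C_derive_pow (fun x => x) z 1 j (is_C_derive_id z))
                   (is_C_derive_pow f z l k Hf))
                 (@is_derive_const C_AbsRing C_NormedModule (RtoC 1) z)).
  transitivity ((z ^ S j * f z ^ S k) * (INR (S j) * f z + INR (S k) * z * l));
    [rewrite Ez; ring|].
  transitivity (z * f z * (INR (S j) * z ^ j * 1 * f z ^ S k +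
                           z ^ S j * (INR (S k) * f z ^ k * l)));
    [rewrite !Cpow_S; ring |].
  etransitivity; [apply f_equal, D | apply Cmult_0_r].
Qed.

Lemma smooth_on_pow (U : C -> Prop) (f : C -> C) k :
  smooth_on U f -> smooth_on U (fun z => f z ^ k).
Proof.
  intros Hf. induction k as [|k IH]; [exact (smooth_on_const U 1)|].
  exact (smooth_on_mult U f (fun z => f z ^ k) Hf IH).
Qed.

Lemma smooth_on_continuous (U : C -> Prop) (f : C -> C) z : smooth_on U f -> U z ->
  @continuous C_UniformSpace R_UniformSpace (fun x => Re (f x)) z /\
  @continuous C_UniformSpace R_UniformSpace (fun x => Im (f x)) z.
Proof.
  intros H Uz. destruct (H 0%nat) as [H1 H2].
  split; [exact (real_class_continuous 0 U _ z H1 Uz) | exact (real_class_continuous 0 U _ z H2 Uz)].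
Qed.

Lemma continuous_punctured_eq (U : C -> Prop) (g : C -> R) (c : R) z :
  @open C_UniformSpace U -> U z -> @continuous C_UniformSpace R_UniformSpace g z ->
  (forall x, U x -> x <> z -> g x = c) -> g z = c.
Proof.
  intros oU Uz Hg E. destruct (Req_dec (g z) c) as [|N]; [assumption | exfalso].
  assert (e0 : (0 < Rabs (g z - c))%R) by (apply Rabs_pos_lt; lra).
  assert (B : locally z (fun x => ball (g z) (mkposreal _ e0) (g x)))
    by (apply Hg; now exists (mkposreal _ e0)).
  destruct (filter_and _ _ (oU z Uz) B) as [d Hd].
  (* No point of the plane is isolated: [t] lies in the same small ball and differs from [z]. *)
  destruct z as [x y]. set (t := (x + d / 2, y)%R : C).
  assert (d0 := cond_pos d).
  destruct (Hd t) as [Ut Bt].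
  { split; [|apply ball_center]. change (Rabs (x + d / 2 - x) < d)%R.
    replace (x + d / 2 - x)%R with (d / 2)%R by ring. rewrite Rabs_pos_eq; lra. }
  rewrite (E t Ut) in Bt.
  - change (Rabs (c - g (x, y)) < Rabs (g (x, y) - c))%R in Bt.
    rewrite Rabs_minus_sym in Bt. lra.
  - intros Et. apply (f_equal fst) in Et. simpl in Et. lra.
Qed.

Lemma smooth_punctured_eq (U : C -> Prop) (f : C -> C) (c z : C) :
  @open C_UniformSpace U -> U z -> smooth_on U f ->
  (forall x, U x -> x <> z -> f x = c) -> f z = c.
Proof.
  intros oU Uz Hf E. destruct (smooth_on_continuous U f z Hf Uz) as [h1 h2].
  apply injective_projections.
  - apply (continuous_punctured_eq U _ (fst c) z oU Uz h1). intros x Ux N. now rewrite E.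
  - apply (continuous_punctured_eq U _ (snd c) z oU Uz h2). intros x Ux N. now rewrite E.
Qed.

Lemma is_derive_change {X : atlas} {i j : chart X} (p : change X i j) z : source p z ->
  @is_derive C_AbsRing C_NormedModule p z (C_derive p z).
Proof. intros Sz. apply (C_derive_correct _ _ 0), (proj2 (change_holomorphic p)), Sz. Qed.

Lemma smooth_change_derive {X : atlas} {i j : chart X} (p : change X i j) :
  smooth_on (source p) (C_derive p).
Proof. apply smooth_on_C_derive; [apply change_holomorphic | apply source_open]. Qed.

Lemma change_derive_comp {X : atlas} {i j k : chart X}
  (p : change X i j) (q : change X j k) (r : change X i k) :
  (forall z, source r z -> source p z /\ source q (p z) /\ r z = q (p z)) ->
  forall z, source r z -> C_derive r z = C_derive q (p z) * C_derive p z.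
Proof.
  intros H z Hz. destruct (H z Hz) as (Sp & Sq & _).
  rewrite Cmult_comm.
  apply (is_C_derive_locally_eq (source r) r (fun x => q (p x)) z).
  - apply source_open.
  - exact Hz.
  - intros x Sx. apply H, Sx.
  - now apply is_derive_change.
  - apply is_C_derive_comp; now apply is_derive_change.
Qed.

(** * Changes of charts of the orbisphere *)

Section Orbisphere.
Variables n m : nat.
Hypothesis n1 : (1 <= n)%nat.
Hypothesis m1 : (1 <= m)%nat.
Let X := orbisphere_atlas n m.

Lemma orbisphere_order_pos i : (1 <= order X i)%nat.
Proof. destruct i; assumption. Qed.

Lemma same_pole_pow i (p : change X i i) z : source p z ->
  p z ^ order X i = z ^ order X i.
Proof.
  intros Sz. assert (E := change_proj p z Sz). symmetry in E.
  apply orbisphere_orbit in E; [|assumption..].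
  symmetry. apply rotation_orbit; [apply orbisphere_order_pos | exact E].
Qed.

Lemma opposite_pole_pow i j (p : change X i j) z : i <> j -> source p z ->
  z ^ order X i * p z ^ order X j = 1.
Proof.
  intros ij Sz. assert (E := change_proj p z Sz).
  destruct i, j; try (now destruct ij); simpl in *.
  - destruct (Ceq_dec (p z) 0) as [|w0]; [discriminate|].
    rewrite <- (Some_inj _ _ _ E). field. now apply Cpow_nz.
  - destruct (Ceq_dec z 0) as [|w0]; [discriminate|].
    rewrite (Some_inj _ _ _ E). field. now apply Cpow_nz.
Qed.

Lemma same_pole_derive i (p : change X i i) z : source p z -> p z = C_derive p z * z.
Proof.
  intros Sz. apply (derive_of_pow_eq (source p) p z _ (order X i)).
  - apply orbisphere_order_pos.
  - apply source_open.
  - exact Sz.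
  - intros x Sx. now apply same_pole_pow.
  - now apply is_derive_change.
Qed.

(** Away from 0 the derivative is [p z / z], a quotient of two points of one orbit. The value at the
    cone point follows by continuity of the derivative. *)
Lemma same_pole_derive_pow i (p : change X i i) z : source p z ->
  C_derive p z ^ order X i = 1.
Proof.
  assert (G : forall x, source p x -> x <> 0 -> C_derive p x ^ order X i = 1).
  { intros x Sx x0. assert (E := same_pole_pow i p x Sx).
    rewrite (same_pole_derive i p x Sx), Cpow_mult_l in E.
    assert (N := Cpow_nz x (order X i) x0).
    transitivity (C_derive p x ^ order X i * x ^ order X i / x ^ order X i);
      [field; exact N | rewrite E; field; exact N]. }
  intros Sz. destruct (Ceq_dec z 0) as [->|z0]; [|now apply G].
  apply (smooth_punctured_eq (source p) (fun x => C_derive p x ^ order X i)).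
  - apply source_open.
  - exact Sz.
  - apply smooth_on_pow, smooth_change_derive.
  - exact G.
Qed.

Lemma opposite_pole_derive i j (p : change X i j) z : i <> j -> source p z ->
  INR (order X i) * p z + INR (order X j) * z * C_derive p z = 0.
Proof.
  intros ij Sz. apply (derive_of_pow_mul_eq1 (source p)).
  - apply orbisphere_order_pos.
  - apply orbisphere_order_pos.
  - apply source_open.
  - exact Sz.
  - intros x Sx. now apply opposite_pole_pow.
  - now apply is_derive_change.
Qed.

Lemma opposite_pole_neq0 i j (p : change X i j) z : i <> j -> source p z ->
  z <> 0 /\ p z <> 0.
Proof.
  intros ij Sz. assert (E := opposite_pole_pow i j p z ij Sz).
  assert (Z : forall k, (1 <= k)%nat -> (0 : C) ^ k = 0)
    by (intros [|k] H; [lia | rewrite Cpow_S; ring]).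
  split; intros E0; apply C1_nz; rewrite <- E, E0, Z by apply orbisphere_order_pos; ring.
Qed.

(** * Gluing functions of the square root *)

Definition pole_eq_dec (i j : pole) : {i = j} + {i <> j}.
Proof. decide equality. Defined.

(** For odd order [k] this is [(k - 1) / 2], half of the weight [k - 1] of the canonical bundle. *)
Definition weight (i : pole) : nat := Nat.div2 (order X i).

(* The quotient of the sections [z ^ a] and [u ^ - (b + 1)] of the header, with
   [z ^ n * u ^ m = 1] used to remove the negative exponents. *)
Definition spin_glue (i j : pole) (p : change X i j) (z : C) : C :=
  if pole_eq_dec i j then C_derive p z ^ weight i
  else z ^ S (weight i) * p z ^ weight j.

Lemma spin_glue_same i (p : change X i i) z : spin_glue i i p z = C_derive p z ^ weight i.
Proof. unfold spin_glue. now destruct (pole_eq_dec i i). Qed.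

Lemma spin_glue_opposite i j (p : change X i j) z : i <> j ->
  spin_glue i j p z = z ^ S (weight i) * p z ^ weight j.
Proof. unfold spin_glue. now destruct (pole_eq_dec i j). Qed.

Lemma spin_glue_neq0 i j (p : change X i j) z : source p z -> spin_glue i j p z <> 0.
Proof.
  intros Sz. unfold spin_glue. destruct (pole_eq_dec i j) as [e|ne].
  - apply Cpow_nz. now apply change_etale.
  - destruct (opposite_pole_neq0 i j p z ne Sz).
    apply Cmult_neq_0; now apply Cpow_nz.
Qed.

Lemma spin_glue_smooth i j (p : change X i j) : smooth_on (source p) (spin_glue i j p).
Proof.
  unfold spin_glue. destruct (pole_eq_dec i j).
  - apply smooth_on_pow, smooth_change_derive.
  - apply smooth_on_mult; apply smooth_on_pow; [intros k; apply class_C_id|].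
    apply change_holomorphic.
Qed.

(** The constants in [dw = n z ^ (n - 1) dz] and [dw = - m u ^ (- m - 1) du]; multiplication by them
    will be the isomorphism to the canonical bundle. *)
Definition canonical_factor (i : pole) : C :=
  match i with cone_zero => INR n | cone_infinity => - INR m end.

Lemma canonical_factor_neq0 i : canonical_factor i <> 0.
Proof.
  destruct i; simpl.
  - destruct n; [lia|]. apply INR_S_C_neq0.
  - destruct m; [lia|]. intros E. apply (INR_S_C_neq0 n0).
    transitivity (- - INR (S n0)); [ring | rewrite E; ring].
Qed.

Hypothesis odd_n : Nat.Odd n.
Hypothesis odd_m : Nat.Odd m.

Lemma order_weight i : order X i = (S (weight i) + weight i)%nat.
Proof.
  assert (O : Nat.Odd (order X i)) by (destruct i; assumption).
  destruct O as [k E]. unfold weight. rewrite E at 2 3.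
  replace (2 * k + 1)%nat with (S (2 * k)) by lia.
  rewrite Nat.div2_succ_double. lia.
Qed.

Lemma spin_glue_comp i j k (p : change X i j) (q : change X j k) (r : change X i k) :
  (forall z, source r z -> source p z /\ source q (p z) /\ r z = q (p z)) ->
  forall z, source r z -> spin_glue i k r z = spin_glue j k q (p z) * spin_glue i j p z.
Proof.
  intros H z Sr. destruct (H z Sr) as (Sp & Sq & Er).
  destruct (pole_eq_dec i j) as [e|ij]; [destruct e|];
    [|destruct (pole_eq_dec j k) as [e|jk]; [destruct e|]].
  - destruct (pole_eq_dec i k) as [e|ik]; [destruct e|].
    + rewrite !spin_glue_same, <- Cpow_mult_l. f_equal. now apply change_derive_comp.
    + rewrite spin_glue_same, !spin_glue_opposite by exact ik.
      (* Writing [p z] as the derivative times [z] leaves a surplus power of the derivative, whose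
         exponent is exactly the order of the cone point. *)
      rewrite <- Er. rewrite (same_pole_derive i p z Sp) at 1.
      assert (D := same_pole_derive_pow i p z Sp). rewrite order_weight, Cpow_add_r in D.
      rewrite Cpow_mult_l.
      transitivity ((C_derive p z ^ S (weight i) * C_derive p z ^ weight i) *
                    (z ^ S (weight i) * r z ^ weight k)); [rewrite D|]; ring.
  - rewrite spin_glue_same, !spin_glue_opposite by exact ij.
    rewrite Er, (same_pole_derive j q (p z) Sq), Cpow_mult_l. ring.
  (* There are only two poles, so two crossings lead back to the first. The leftover powers form the
     product of [opposite_pole_pow], which is 1. *)
  - assert (ik : i = k) by (destruct i, j, k; congruence). destruct ik.
    rewrite spin_glue_same, !spin_glue_opposite by assumption.
    rewrite <- Er, (same_pole_derive i r z Sr), Cpow_mult_l.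
    assert (E := opposite_pole_pow i j p z ij Sp).
    rewrite !order_weight, !Cpow_add_r in E.
    transitivity ((z ^ S (weight i) * z ^ weight i * (p z ^ S (weight j) * p z ^ weight j))
                  * C_derive r z ^ weight i); [rewrite E|]; ring.
Qed.

(** Within a chart, the derivative to the power [2 * weight i] is its inverse, because one more
    factor gives 1. Between charts, the square of the gluing function reduces to [z / p z], which
    the logarithmic derivative relates to the derivative of [p]. *)
Lemma spin_glue_square i j (p : change X i j) z : source p z ->
  canonical_factor j * (spin_glue i j p z * spin_glue i j p z) =
  / C_derive p z * canonical_factor i.
Proof.
  intros Sz. assert (N := change_etale p z Sz).
  destruct (pole_eq_dec i j) as [e|ij]; [destruct e|].
  - assert (D := same_pole_derive_pow i p z Sz). rewrite order_weight, Cpow_add_r, Cpow_S in D.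
    rewrite spin_glue_same.
    transitivity (canonical_factor i * (C_derive p z * C_derive p z ^ weight i *
      C_derive p z ^ weight i) * / C_derive p z); [|rewrite D; ring].
    field. exact N.
  - destruct (opposite_pole_neq0 i j p z ij Sz) as [z0 w0].
    assert (E := opposite_pole_pow i j p z ij Sz).
    rewrite !order_weight, !Cpow_add_r in E.
    assert (S2 : spin_glue i j p z * spin_glue i j p z = z / p z).
    { rewrite spin_glue_opposite by exact ij.
      transitivity ((z ^ S (weight i) * z ^ weight i * (p z ^ S (weight j) * p z ^ weight j))
                    * (z / p z)); [|rewrite E; field; exact w0].
      rewrite !Cpow_S. field. exact w0. }
    rewrite S2.
    assert (D := opposite_pole_derive i j p z ij Sz).
    (* The opposite signs of the two constants turn the vanishing sum [D] into an equality, in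
       either direction between the poles. *)
    assert (F : canonical_factor j * z * C_derive p z = canonical_factor i * p z).
    { destruct i, j; try (now destruct ij); simpl in D |- *.
      - transitivity (INR n * p z - (INR n * p z + INR m * z * C_derive p z));
          [ring | rewrite D; ring].
      - transitivity ((INR m * p z + INR n * z * C_derive p z) - INR m * p z);
          [ring | rewrite D; ring]. }
    transitivity (canonical_factor j * z * C_derive p z / (p z * C_derive p z));
      [field; now split | rewrite F; field; now split].
Qed.

End Orbisphere.

(* Existence for odd orders *)
#[local] Obligation Tactic := idtac.

(** The charts carry the same globally framed bundles as the canonical bundle, so only the gluing
    distinguishes the two. *)
Program Definition spin_bundle (n m : nat) (hn : (2 <= n)%nat) (hm : (2 <= m)%nat)
    (on : Nat.Odd n) (om : Nat.Odd m) : orbi_line_bundle (orbisphere n m hn hm) :=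
  {| chart_bundle := chart_bundle (canonical (orbisphere n m hn hm));
     glue := spin_glue n m |}.
Next Obligation. intros n m hn hm on om i j p z. apply spin_glue_neq0; lia. Qed.
Next Obligation.
  intros n m hn hm on om i j p a b; cbn.
  apply (smooth_on_sub (source p)); [tauto|].
  apply (smooth_on_ext _ (spin_glue n m i j p)); [apply source_open | | apply spin_glue_smooth].
  intros z _. field.
Qed.
Next Obligation. intros n m hn hm on om i j k p q r. apply spin_glue_comp; (assumption || lia). Qed.

Lemma spin_bundle_half_form n m hn hm on om :
  half_form_bundle (spin_bundle n m hn hm on om).
Proof.
  exists (fun i _ => canonical_factor n m i). split; [|split].
  - intros i z _. apply canonical_factor_neq0; lia.
  - intros i a b. cbn.
    apply (smooth_on_ext _ (fun _ => canonical_factor n m i)).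
    + apply open_and; [apply open_and|]; apply open_disk.
    + intros z _. field.
    + apply smooth_on_const.
  - intros i j p z Sz. apply spin_glue_square; (assumption || lia).
Qed.

Theorem mainTheorem12 (n m : nat) (hn : (2 <= n)%nat) (hm : (2 <= m)%nat) :
  (exists delta : orbi_line_bundle (orbisphere n m hn hm), half_form_bundle delta) <->
  Nat.Odd n /\ Nat.Odd m.
Proof.
  split.
  - intros [delta H]. split.
    + exact (half_form_order_odd delta cone_zero H).
    + exact (half_form_order_odd delta cone_infinity H).
  - intros [on om]. exists (spin_bundle n m hn hm on om). apply spin_bundle_half_form.
Qed.
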